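(* Let $s\ge1$ and $p\ge1$ be integers with $2s\ge p+3$, and consider the scheme $$V^{n+1} = D V^n + \Delta t\, A\, F(V^n) + \Delta t\, R\, F(V^{n+1})$$ with $D,A,R\in\mathbb{R}^{s\times s}$ and abscissas $c=(c_1,\dots,c_s)^T$, applied to the scalar ODE $u_t=F(u)$ with the setting, notation and standing assumptions given in the context. Suppose that $D$ has rank one and $D\mathbb{1}=\mathbb{1}$; that $\tau_j=0$ for $j=1,\dots,p$; that $D\tau_{p+1}=0$, $D\tau_{p+2}=0$, $D(A+R)\tau_{p+1}=0$; and that the method is initialized accurately enough that $E^1=\Delta t^{p+1}\tau^1_{p+1}+\Delta t^{p+2}\tau^1_{p+2}+O(\Delta t^{p+3})$. For $n\ge2$ let $\tilde V^n=\binom{V^{n-1}}{V^n}$, $\tilde U^n=\binom{U^{n-1}}{U^n}$, $\tilde\tau=\binom{\tau_{p+1}}{\tau_{p+1}}$ be concatenated vectors in $\mathbb{R}^{2s}$, and let $$\tilde t=(t_{n-1}+c_1\Delta t,\dots,t_{n-1}+c_s\Delta t,\;t_n+c_1\Delta t,\dots,t_n+c_s\Delta t)^T.$$ Let $P_0,\dots,P_{p+1}$ be polynomials of degree at most $p+1$ with $\mathrm{span}\{P_0(t-t_n),\dots,P_{p+1}(t-t_n)\}=\mathrm{span}\{1,(t-t_n),\dots,(t-t_n)^{p+1}\}$, and let $\mathbf{P}_0,\dots,\mathbf{P}_{p+1}\in\mathbb{R}^{2s}$ be the vectors of their values at the entries of $\tilde t$. Assume $\tilde\tau\notin\mathrm{span}\{\mathbf{P}_0,\dots,\mathbf{P}_{p+1}\}$.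 Let $T\in\mathbb{C}^{2s\times 2s}$ be an invertible matrix whose first column is $\tilde\tau$, whose next $p+2$ columns are $\mathbf{P}_0,\dots,\mathbf{P}_{p+1}$, and whose remaining $2s-(p+3)$ columns are arbitrary subject to invertibility. Define $$\Phi=T\,\mathrm{diag}\bigl(0,\underbrace{1,\dots,1}_{p+2},\underbrace{*,\dots,*}_{2s-(p+3)}\bigr)\,T^{-1},$$ where each $*$ is either $0$ or $1$, and assume that $\|\Phi\|$ is bounded uniformly in $\Delta t$ and $n$. Then the post-processed solution is accurate to order $p+2$: $$\Phi\,\tilde V^n=\tilde U^n+O(\Delta t^{p+2})\qquad(\Delta t\to0),$$ for all $n\ge 2$ with $t_n$ in the bounded time interval of integration.
   Context: Setting. $u$ is the solution of the scalar autonomous ODE $u_t=F(u)$, where $F:\mathbb{R}\to\mathbb{R}$ and $u$ are as smooth as needed on a bounded time interval containing all time points used. The time-step $\Delta t>0$ is fixed and $t_n=t_0+n\Delta t$. The abscissas satisfy $c_1\le\dots\le c_s=0$. The vector $V^n\in\mathbb{R}^s$ has as its $j$-th entry the numerical approximation to $u(t_n+c_j\Delta t)$; the exact vector is $U^n=(u(t_n+c_1\Delta t),\dots,u(t_n+c_s\Delta t))^T$; $F$ acts component-wise on vectors. The global error is $E^n=V^n-U^n$. $\mathbb{1}=(1,\dots,1)^T\in\mathbb{R}^s$. Truncation error vectors: for $j\ge 1$, $$\tau_j=\frac{1}{(j-1)!}\left(\frac1j D(c-\mathbb{1})^j+A(c-\mathbb{1})^{j-1}+R\,c^{j-1}-\frac1j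 c^j\right)\in\mathbb{R}^s,$$ with powers of vectors taken component-wise (and $0^0=1$), and $\tau^n_j=\tau_j\,\frac{d^j u}{dt^j}(t_n)$. Standing assumptions. For all sufficiently small $\Delta t$ the (possibly nonlinear) map $W\mapsto W-\Delta t\,R\,F(W)$ on $\mathbb{R}^s$ is invertible with inverse Lipschitz with a constant independent of $\Delta t$, so that $V^{n+1}$ is well defined from $V^n$; and the one-step map $V^n\mapsto V^{n+1}$ is Lipschitz with a constant $L$ independent of $n$ and $\Delta t$. The scheme is applied for $n\ge1$ starting from $V^1$ satisfying the stated condition on $E^1$. *)

(* Defs.v *)
From HB Require Import structures.
From mathcomp Require Import all_boot all_order all_algebra.
From mathcomp Require Import complex.
From mathcomp Require Import all_classical all_reals all_analysis.

Set Implicit Arguments.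
Unset Strict Implicit.
Unset Printing Implicit Defensive.

Import Order.TTheory GRing.Theory Num.Theory.
Import numFieldNormedType.Exports.

Local Open Scope classical_set_scope.
Local Open Scope complex_scope.
Local Open Scope ring_scope.

Section Defs.
Variable K : realType.

(* f is of class C^k on the set A, which is meant to be open: [derive1n j f] is a
   two-sided derivative, so smoothness on a closed interval has to be stated on
   an open interval containing it. *)
Definition smooth_on (k : nat) (f : K -> K) (A : set K) : Prop :=
  forall x, A x ->
    (forall j, (j < k)%N -> derivable (derive1n j f) x 1) /\
    {for x, continuous (derive1n k f)}.

Definition solves_on (F u : K -> K) (A : set K) : Prop :=
  forall t, A t -> derivable u t 1 /\ derive1 u t = F (u t).

(* Component-wise power; [x ^+ 0 = 1] for every x, including x = 0. *)
Definition cpow (s : nat) (v : 'cV[K]_s) (j : nat) : 'cV[K]_s :=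
  map_mx (fun x => x ^+ j) v.

Definition ones (s : nat) : 'cV[K]_s := const_mx 1.

(* The truncation error vector tau_j, for j >= 1; the value at j = 0 has no
   meaning. *)
Definition tau (s : nat) (D A R : 'M[K]_s) (c : 'cV[K]_s) (j : nat) :
    'cV[K]_s :=
  (j.-1)`!%:R^-1 *:
    (j%:R^-1 *: (D *m cpow (c - ones s) j) + A *m cpow (c - ones s) j.-1
     + R *m cpow c j.-1 - j%:R^-1 *: cpow c j).

Definition tgrid (t0 dt : K) (n : nat) : K := t0 + n%:R * dt.

Definition stages (s : nat) (t0 dt : K) (c : 'cV[K]_s) (n : nat) : 'cV[K]_s :=
  \col_j (tgrid t0 dt n + c j 0 * dt).

Definition exact_vec (s : nat) (u : K -> K) (t0 dt : K) (c : 'cV[K]_s)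
    (n : nat) : 'cV[K]_s :=
  map_mx u (stages t0 dt c n).

Definition trunc (s : nat) (D A R : 'M[K]_s) (c : 'cV[K]_s) (u : K -> K)
    (t0 dt : K) (n j : nat) : 'cV[K]_s :=
  derive1n j u (tgrid t0 dt n) *: tau D A R c j.

(* One step of the scheme reads
   [implicit_map R F dt V^(n+1) = explicit_map D A F dt V^n]. *)
Definition implicit_map (s : nat) (R : 'M[K]_s) (F : K -> K) (dt : K)
    (W : 'cV[K]_s) : 'cV[K]_s :=
  W - dt *: (R *m map_mx F W).

Definition explicit_map (s : nat) (D A : 'M[K]_s) (F : K -> K) (dt : K)
    (W : 'cV[K]_s) : 'cV[K]_s :=
  D *m W + dt *: (A *m map_mx F W).

(* Stacks the vectors of the steps n - 1 and n; only used for n >= 1. *)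
Definition stack2 (s : nat) (X : nat -> 'cV[K]_s) (n : nat) : 'cV[K]_(s + s) :=
  col_mx (X n.-1) (X n).

(* Linear span of a finite family in a possibly infinite-dimensional module. *)
Definition lspan (E : lmodType K) (m : nat) (v : 'I_m -> E) : set E :=
  [set x | exists a : 'I_m -> K, x = \sum_(k < m) a k *: v k].

(* The polynomial P(t - a) in the variable t. *)
Definition shiftp (P : {poly K}) (a : K) : {poly K} := P \Po ('X - a%:P).

Definition values (m : nat) (P : {poly K}) (t : 'cV[K]_m) : 'cV[K]_m :=
  map_mx (fun x => P.[x]) t.

Definition toC (m n : nat) (M : 'M[K]_(m, n)) : 'M[K[i]]_(m, n) :=
  map_mx (real_complex K) M.

(* The row (0, 1, ..., 1, *, ..., * ) with q ones; [star j] tells whether the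
   entry * in position j is 1. *)
Definition filter_diag (m q : nat) (star : 'I_m -> bool) : 'rV[K[i]]_m :=
  \row_(j < m) (if j == 0%N :> nat then 0
                else if (j <= q)%N then 1
                else (star j)%:R).

Definition postproc (m q : nat) (star : 'I_m -> bool) (T : 'M[K[i]]_m) :
    'M[K[i]]_m :=
  T *m diag_mx (filter_diag q star) *m invmx T.

End Defs.

(* Main.v *)
Require Import Defs.
From HB Require Import structures.
From mathcomp Require Import all_boot all_order all_algebra.
From mathcomp Require Import complex.
From mathcomp Require Import all_classical all_reals all_analysis.
From mathcomp Require Import ring lra.

Set Implicit Arguments.
Unset Strict Implicit.
Unset Printing Implicit Defensive.

Import Order.TTheory GRing.Theory Num.Theory.
Import numFieldNormedType.Exports.

Local Open Scope classical_set_scope.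
Local Open Scope complex_scope.
Local Open Scope ring_scope.

(* The local truncation error is [dt^(p+1) tau_(p+1) + dt^(p+2) tau_(p+2)] up to
   [O(dt^(p+3))].  Write the global error as [E^n = dt^(p+1) tau^n_(p+1) + e^n].
   Since [D] has rank one and fixes the vector of ones, it is a projection, so
   only [D e^n] accumulates over the steps.  The kernel conditions on
   [tau_(p+1)] and [tau_(p+2)] remove from its increment every term of order
   [dt^(p+2)], and a discrete Gronwall argument gives [e^n = O(dt^(p+2))].  The
   Lipschitz constant of the one-step map may exceed 1 and so gives no
   stability; it only keeps [V^(n+1)] in a bounded region, where [F] can be
   linearised.  The post-processor annihilates the leading term of the error and
   fixes the Taylor polynomial of degree [p+1] of [u]. *)

(** * A discrete Gronwall estimate *)

(* [a n + 2 C h b n] grows by a factor [1 + 6 C h] per step: the weight [2 C h]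
   absorbs the coupling between [a] and [b].  The a priori bounds [e <= 1]
   needed for the recursion are recovered along the way from the Lipschitz
   estimate on [e]. *)
Lemma error_recursion (K : realType) (p : nat) (C L T B S : K) :
    0 <= C -> 0 <= L -> 0 <= T -> 0 <= B -> 0 <= S ->
  exists K0 h0 : K, [/\ 0 <= K0, 0 < h0 &
    forall (h : K) (a b e : nat -> K) (N : nat),
      0 < h -> h <= h0 -> N%:R * h <= S ->
      (forall n, 0 <= a n) -> (forall n, 0 <= b n) -> (forall n, 0 <= e n) ->
      a 1%N <= B * h ^+ p.+2 -> b 1%N <= B * h ^+ p.+2 ->
      (forall n, (1 <= n <= N)%N -> e n <= T * h ^+ p.+1 + b n) ->
      (forall n, (1 <= n < N)%N -> e n.+1 <= L * (e n + h ^+ p.+1)) ->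
      (forall n, (1 <= n < N)%N -> e n <= 1 -> e n.+1 <= 1 ->
         b n.+1 <= a n + C * h ^+ p.+2 + C * h * (b n + b n.+1) /\
         a n.+1 <= a n + C * h ^+ p.+3 + C * h * (b n + b n.+1)) ->
      forall n, (1 <= n <= N)%N -> b n <= K0 * h ^+ p.+2].
Proof.
move=> C0 L0 T0 B0 S0.
(* [G] is the coefficient of [h ^+ p.+3] in one step of the weighted sum [w]: [C] from [a], and
   [6 C^2] from [3 C h] times the [2 C h ^+ p.+2] in the bound of [b n.+1]. [W] bounds [w] in units
   of [h ^+ p.+2]. *)
pose G := C + 6 * C ^+ 2.
have G0 : 0 <= G by rewrite addr_ge0// mulr_ge0// exprn_ge0.
pose W := expR (6 * C * S) * (2 * B + S * G).
have W0 : 0 <= W by rewrite mulr_ge0 ?expR_ge0 ?addr_ge0 ?mulr_ge0.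
pose K0 := B + 2 * W + 2 * C.
have K00 : 0 <= K0 by rewrite /K0; lra.
(* The choice [h <= Z^-1] encodes at once the four smallness conditions [h1], [hC], [hT] and
   [hL]. *)
pose Z := 1 + 6 * C + (T + K0) + L * (T + K0 + 1).
have LTK : 0 <= L * (T + K0 + 1) by rewrite mulr_ge0//; lra.
have Z0 : 0 < Z by rewrite /Z; lra.
exists K0, Z^-1; split => //; first by rewrite invr_gt0.
move=> h a b e N h0 hZ NhS a0 b0 e0 aB bB eb eL rec.
have h0' := ltW h0.
have {hZ} hZ : h * Z <= 1 by rewrite -ler_pdivlMr// mul1r.
have hC0 : 0 <= C * h by rewrite mulr_ge0.
have hTK0 : 0 <= (T + K0) * h.
  by rewrite mulr_ge0// addr_ge0.
have hL0 : 0 <= L * (T + K0 + 1) * h by rewrite mulr_ge0.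
have hZE : h * Z = h + 6 * (C * h) + (T + K0) * h + L * (T + K0 + 1) * h.
  by rewrite /Z; ring.
have h1 : h <= 1 by lra.
have hC : 6 * (C * h) <= 1 by lra.
have hT : (T + K0) * h <= 1 by lra.
have hL : L * (T + K0 + 1) * h <= 1 by lra.
have hp1 : h ^+ p.+1 <= h by rewrite exprS ler_piMr// exprn_ile1.
have hp2 : h ^+ p.+2 <= h ^+ p.+1 by rewrite exprS ler_piMl// exprn_ge0.
have hpg n : 0 <= h ^+ n by rewrite exprn_ge0.
pose x := 6 * (C * h).
have x0 : 0 <= x by rewrite mulr_ge0.
have growth n : (n <= N)%N -> (1 + x) ^+ n <= expR (6 * C * S).
  move=> nN; apply: le_trans (_ : expR x ^+ n <= _).
    by rewrite lerXn2r ?nnegrE ?expR_ge0 ?expR_ge1Dx//; lra.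
  rewrite -expRM_natl ler_expR.
  have : n%:R * h <= S by apply: le_trans NhS; rewrite ler_pM2r// ler_nat.
  have -> : n%:R * x = 6 * C * (n%:R * h) by rewrite /x; ring.
  by move=> ?; rewrite ler_wpM2l// mulr_ge0.
pose w n := a n + 2 * (C * h) * b n.
have step n : (1 <= n < N)%N -> e n <= 1 -> e n.+1 <= 1 ->
    b n.+1 <= 2 * w n + 2 * C * h ^+ p.+2 /\
    w n.+1 <= (1 + x) * w n + G * h ^+ p.+3.
  move=> nN en1 eS1; have [bS aS] := rec _ nN en1 eS1.
  (* Since [C h <= 1/6], the implicit term in [b n.+1] moves to the left, and the resulting factor
     [6/5] is rounded up to [2]. *)
  have Cb : C * h * b n.+1 <= 6^-1 * b n.+1 by rewrite ler_wpM2r//; lra.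
  have bw : b n.+1 <= 2 * a n + 2 * C * h ^+ p.+2 + 2 * (C * h) * b n.
    have := b0 n.+1; have := a0 n; have : 0 <= C * h ^+ p.+2 by rewrite mulr_ge0.
    have : 0 <= C * h * b n by rewrite mulr_ge0.
    by rewrite mulrDr in bS; lra.
  split; first by rewrite /w; have := mulr_ge0 hC0 (b0 n); lra.
  have bw3 : 3 * (C * h) * b n.+1 <=
      3 * (C * h) * (2 * a n + 2 * C * h ^+ p.+2 + 2 * (C * h) * b n).
    by rewrite ler_wpM2l// mulr_ge0.
  have xb : x * (C * h * b n) <= 1 * (C * h * b n).
    by rewrite ler_wpM2r// mulr_ge0.
  have xb0 : 0 <= x * (C * h * b n) by rewrite !mulr_ge0.
  rewrite /w; apply: (@le_trans _ _ (a n + C * h ^+ p.+3 + C * h * b n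
      + 3 * (C * h) * b n.+1)); first by rewrite mulrDr in aS; lra.
  rewrite /x /G in bw3 xb xb0 *.
  rewrite (exprS h p.+2); set H := h ^+ p.+2 in bw3 *.
  by move: bw3 xb xb0; lra.
(* Both bounds share one induction: the one on [w] at [n] yields the one on [b] at [n.+1], and the
   one on [b] gives the smallness of [e] on which [step] depends. *)
have main n : (1 <= n <= N)%N ->
    w n <= (1 + x) ^+ n * (2 * B * h ^+ p.+2 + n%:R * (G * h ^+ p.+3)) /\
    b n <= K0 * h ^+ p.+2.
  elim: n => // n IH nN.
  case: n => [|n] in IH nN *.
    split; last first.
      by rewrite (le_trans bB)// ler_wpM2r// /K0; lra.
    have hC2 : 2 * (C * h) * b 1%N <= 1 * b 1%N by rewrite ler_wpM2r//; lra.
    rewrite expr1 mul1r; apply: (@le_trans _ _ (1 * (2 * B * h ^+ p.+2))).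
      by rewrite /w; lra.
    apply: ler_pM => //; [by rewrite mulr_ge0// mulr_ge0 | lra |].
    by rewrite lerDl mulr_ge0.
  have nN' : (1 <= n.+1 < N)%N by [].
  have nN'' : (1 <= n.+1 <= N)%N by rewrite /= ltnW.
  have [wn bn] := IH nN''.
  have en : e n.+1 <= (T + K0) * h ^+ p.+1.
    apply: (le_trans (eb _ nN'')); rewrite mulrDl lerD2l.
    by apply: (le_trans bn); rewrite ler_wpM2l.
  have en1 : e n.+1 <= 1.
    by apply: (le_trans en); apply: le_trans hT; rewrite ler_wpM2l// addr_ge0.
  have eS1 : e n.+2 <= 1.
    apply: (le_trans (eL _ nN')); apply: le_trans hL.
    rewrite -mulrA ler_wpM2l// mulrDl mul1r.
    by apply: lerD => //; apply: (le_trans en); rewrite ler_wpM2l// addr_ge0.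
  have [bS wS] := step _ nN' en1 eS1.
  have wW : w n.+1 <= W * h ^+ p.+2.
    apply: (le_trans wn); rewrite /W -(mulrA (expR _)); apply: ler_pM.
    - by rewrite exprn_ge0// addr_ge0.
    - by rewrite addr_ge0// mulr_ge0// mulr_ge0.
    - by apply: growth; case/andP: nN''.
    rewrite (mulrDl (2 * B)) lerD2l (exprS h p.+2).
    have -> : n.+1%:R * (G * (h * h ^+ p.+2)) = (n.+1%:R * h) * (G * h ^+ p.+2).
      by ring.
    rewrite -(mulrA S) ler_wpM2r//; first exact: mulr_ge0.
    apply: le_trans NhS; rewrite ler_pM2r// ler_nat.
    by case/andP: nN => _ /ltnW.
  split; last first.
    have := mulr_ge0 B0 (hpg p.+2); rewrite /K0 (mulrDl (B + 2 * W)) (mulrDl B).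
    by move: bS wW; lra.
  apply: (le_trans wS).
  have x1 : 1 <= (1 + x) ^+ n.+2 by rewrite exprn_ege1//; lra.
  apply: (@le_trans _ _ ((1 + x) ^+ n.+2 *
      (2 * B * h ^+ p.+2 + n.+1%:R * (G * h ^+ p.+3)) +
      (1 + x) ^+ n.+2 * (G * h ^+ p.+3))).
    apply: lerD; last by rewrite ler_peMl// mulr_ge0.
    by rewrite exprS -mulrA ler_wpM2l// addr_ge0.
  have -> : n.+2%:R = n.+1%:R + 1 :> K by rewrite natr1.
  rewrite le_eqVlt; apply/orP; left; apply/eqP; ring.
by move=> n nN; have [] := main n nN.
Qed.

(** * Entrywise maximum norm of matrices and rank-one projections *)

Lemma mx_norm_entry_le (K : numDomainType) (m n : nat) (M : 'M[K]_(m, n)) i j :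
  `|M i j| <= `|M|.
Proof.
rewrite [leRHS]/Num.Def.normr /= mx_normE -[leLHS]nngE num_le.
exact: (@le_bigmax _ _ _ _ (fun ij => `|M ij.1 ij.2|%:nng) (i, j)).
Qed.

Lemma mulmx_norm_le (K : numDomainType) (m n q : nat) (A : 'M[K]_(m, n))
    (B : 'M[K]_(n, q)) : `|A *m B| <= n%:R * `|A| * `|B|.
Proof.
rewrite [leLHS]/Num.Def.normr /=.
have [->|/mx_norm_neq0[[i j] ->]] := eqVneq (mx_norm (A *m B)) 0.
  by rewrite !mulr_ge0.
rewrite /= mxE (le_trans (ler_norm_sum _ _ _))//.
have -> : n%:R * `|A| * `|B| = \sum_(k < n) `|A| * `|B|.
  by rewrite sumr_const card_ord -mulrA mulr_natl.
by apply: ler_sum => k _; rewrite normrM ler_pM// mx_norm_entry_le.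
Qed.

Lemma mx_norm_le (K : numDomainType) (m n : nat) (M : 'M[K]_(m, n)) (r : K) :
  0 <= r -> (forall i j, `|M i j| <= r) -> `|M| <= r.
Proof.
move=> r0 Mr; rewrite [leLHS]/Num.Def.normr /=.
by have [->//|/mx_norm_neq0[[i j] ->]] := eqVneq (mx_norm M) 0; exact: Mr.
Qed.

Lemma toC_norm_le (K : realType) (m n : nat) (M : 'M[K]_(m, n)) :
  `|toC M| <= `|M|%:C.
Proof.
apply: mx_norm_le => [|i j]; first by rewrite ler0c.
rewrite mxE normc_def /= expr0n /= addr0 sqrtr_sqr lecR.
exact: mx_norm_entry_le.
Qed.

(** Write [D = x y] with a column [x] and a row [y]. The fixed vector is [(y w) x], so [y w] is a
    nonzero scalar, and applying [y] gives [y x = 1]. *)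
Lemma rank1_idempotent (F : fieldType) (s : nat) (D : 'M[F]_s) (w : 'cV[F]_s) :
  \rank D = 1%N -> w != 0 -> D *m w = w -> D *m D = D.
Proof.
move=> rD w0 Dw; have := mulmx_base D.
move: (col_base D) (row_base D); rewrite rD => x y xy.
have wE : w = (y *m w) 0 0 *: x.
  by rewrite -mul_mx_scalar -mx11_scalar mulmxA xy.
have g0 : (y *m w) 0 0 != 0 by apply: contra_neq w0 => g0; rewrite wE g0 scale0r.
have yx : y *m x = 1%:M.
  apply: (scalerI g0); rewrite scalemxAr -wE [LHS]mx11_scalar.
  by rewrite -scalemx1.
by rewrite -xy mulmxA -(mulmxA x y x) yx mulmx1.
Qed.

(** * Bounds, mean values and Taylor polynomials on a segment *)

(** Each derivative is continuous on a compact segment, hence bounded; the sum of the bounds serves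
    all orders up to [k]. *)
Lemma smooth_on_bounded (K : realType) (k : nat) (f : K -> K) (A : set K)
    (x y : K) : smooth_on k f A -> `[x, y] `<=` A ->
  exists2 B : K, 0 <= B & forall j t, (j <= k)%N -> t \in `[x, y] ->
    `|derive1n j f t| <= B.
Proof.
move=> fA xyA.
have bnd j : exists B : K, (j <= k)%N ->
    forall t, t \in `[x, y] -> `|derive1n j f t| <= B.
  have [jk|] := leqP j k; last by exists 0.
  have cont : {within `[x, y], continuous (derive1n j f)}.
    apply: continuous_in_subspaceT => t; rewrite inE => /xyA/fA[df cf].
    have [jk'|kj] := ltnP j k; last by have -> : j = k by apply/eqP; rewrite eqn_leq jk.
    by apply: differentiable_continuous; apply/derivable1_diffP; exact: df.
  have /compact_bounded[M [_ HM]] :=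
    continuous_compact cont (@segment_compact _ x y).
  exists (M + 1) => _ t txy; apply: HM; first by rewrite ltrDl.
  by exists t.
have [B BP] := choice bnd.
exists (\sum_(j < k.+1) `|B j|); first exact: sumr_ge0.
move=> j t jk txy; apply: (le_trans (BP j jk t txy)).
rewrite (bigD1 (Ordinal (jk : (j < k.+1)%N)))//=.
by apply: (le_trans (ler_norm _)); rewrite lerDl sumr_ge0.
Qed.

(** The points [s] and [t] come in any order, so the position of [xi] is recorded by its distances
    to both. *)
Lemma mvt_between (K : realType) (f : K -> K) (x y s t : K) :
    (forall z, z \in `[x, y] -> derivable f z 1) ->
    s \in `[x, y] -> t \in `[x, y] ->
  exists xi, [/\ xi \in `[x, y], `|xi - t| <= `|s - t|, `|xi - s| <= `|s - t| &
    f s - f t = derive1 f xi * (s - t)].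
Proof.
move=> df.
have mvt u v : u <= v -> u \in `[x, y] -> v \in `[x, y] -> exists xi,
    [/\ xi \in `[x, y], u <= xi, xi <= v & f v - f u = derive1 f xi * (v - u)].
  move=> uv; rewrite !in_itv/= => /andP[xu uy] /andP[xv vy].
  have sub z : z \in `[u, v] -> z \in `[x, y].
    rewrite !in_itv/= => /andP[uz zv].
    by rewrite (le_trans xu uz) (le_trans zv vy).
  have df' z : z \in `]u, v[ -> is_derive z 1 f (derive1 f z).
    move=> zuv; rewrite derive1E; apply: derivableP; apply: df.
    by apply: sub; exact: subset_itv_oo_cc zuv.
  have cf : {within `[u, v], continuous f}.
    apply: continuous_in_subspaceT => z; rewrite inE => zuv.
    apply: differentiable_continuous; apply/derivable1_diffP; apply: df.
    exact: sub.
  have [xi xiuv fE] := MVT_segment uv df' cf.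
  exists xi; split => //; first exact: sub.
    by move: xiuv; rewrite in_itv => /andP[].
  by move: xiuv; rewrite in_itv => /andP[].
move=> sxy txy; have [st|ts] := leP s t.
  have [xi [xixy sxi xit fE]] := mvt _ _ st sxy txy.
  exists xi; split => //.
  - by rewrite ler0_norm ?subr_le0// ler0_norm ?subr_le0//; lra.
  - by rewrite ger0_norm ?subr_ge0// ler0_norm ?subr_le0//; lra.
  - by rewrite -[LHS]opprB fE; ring.
move/ltW in ts; have [xi [xixy txi xis fE]] := mvt _ _ ts txy sxy.
exists xi; split => //.
- by rewrite ger0_norm ?subr_ge0// ger0_norm ?subr_ge0//; lra.
- by rewrite ler0_norm ?subr_le0// ger0_norm ?subr_ge0//; lra.
Qed.

(** An element of [{poly K}] rather than a function, since the post-processor is known through spans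
    of polynomials. The degree is below [k]. *)
Definition taylor_poly (K : realType) (k : nat) (f : K -> K) (t : K) : {poly K} :=
  \sum_(j < k) (derive1n j f t / j`!%:R) *: ('X - t%:P) ^+ j.

Lemma horner_taylor_poly (K : realType) (k : nat) (f : K -> K) (t s : K) :
  (taylor_poly k f t).[s] = \sum_(j < k) derive1n j f t / j`!%:R * (s - t) ^+ j.
Proof.
rewrite horner_sum; apply: eq_bigr => j _.
by rewrite hornerZ horner_exp hornerXsubC.
Qed.

Lemma deriv_taylor_poly (K : realType) (k : nat) (f : K -> K) (t : K) :
  (taylor_poly k.+1 f t)^`() = taylor_poly k (derive1 f) t.
Proof.
rewrite /taylor_poly big_ord_recl /= raddfD /= derivZ.
rewrite expr0 derivC scaler0 add0r raddf_sum /=; apply: eq_bigr => j _.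
rewrite derivZ deriv_exp derivXsubC mul1r -(scaler_nat _ (_ ^+ _)) scalerA.
rewrite /bump leq0n add1n -derive1Sn /=.
congr (_ *: _); rewrite factS natrM invfM -mulrA; congr (_ * _).
by rewrite mulrAC mulVf ?mul1r// pnatr_eq0.
Qed.

(** Induction on [k] over all [f]: the remainder vanishes at [t], and its derivative is the
    remainder of [derive1 f] with one term less, so the mean value theorem gains one factor
    [|s - t|]. The factorial of the sharp constant is given up. *)
Lemma taylor_poly_error (K : realType) (k : nat) (f : K -> K) (x y B : K) :
    (forall j z, (j < k)%N -> z \in `[x, y] -> derivable (derive1n j f) z 1) ->
    (forall z, z \in `[x, y] -> `|derive1n k f z| <= B) ->
  forall s t, s \in `[x, y] -> t \in `[x, y] ->
    `|f s - (taylor_poly k f t).[s]| <= B * `|s - t| ^+ k.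
Proof.
elim: k f => [|k IH] f df fB s t sxy txy.
  by rewrite /taylor_poly big_ord0 horner0 subr0 mulr1; exact: fB.
pose g z := f z - (taylor_poly k.+1 f t).[z].
have dg z : z \in `[x, y] ->
    is_derive z 1 g (derive1 f z - (taylor_poly k (derive1 f) t).[z]).
  move=> zxy; apply: is_deriveB.
    by rewrite derive1E; apply: derivableP; exact: (df 0%N).
  by rewrite -deriv_taylor_poly; exact: is_derive_poly.
have dg' z : z \in `[x, y] -> derivable g z 1 by move=> /dg[].
have [xi [xixy xit _ gE]] := mvt_between dg' sxy txy.
have gt : g t = 0.
  rewrite /g horner_taylor_poly big_ord_recl big1 => [|j _].
    by rewrite /= fact0 divr1 mulr1 addr0 subrr.
  by rewrite subrr expr0n mulr0.
rewrite -/(g s) -[g s]subr0 -gt gE normrM derive1E (@derive_val _ _ _ _ _ _ _ (dg _ xixy)).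
rewrite exprSr mulrA ler_wpM2r//.
have B0 : 0 <= B by apply: le_trans (fB _ sxy).
apply: (@le_trans _ _ (B * `|xi - t| ^+ k)).
  apply: IH => // [j z jk zxy|z zxy]; rewrite -derive1Sn; last exact: fB.
  exact: df.
by rewrite ler_wpM2l// lerXn2r ?nnegrE.
Qed.

(** * Spectral action of the post-processor *)

Lemma postproc_eigen (K : realType) (m q : nat) (star : 'I_m -> bool)
    (T : 'M[K[i]]_m) (j : 'I_m) : T \in unitmx ->
  postproc q star T *m col j T = filter_diag K q star 0 j *: col j T.
Proof.
move=> uT; rewrite /postproc colE -!mulmxA mulKmx// scalemxAr; congr (_ *m _).
apply/matrixP => i k; rewrite !ord1 mul_diag_mx !mxE andbT.
by case: (eqVneq i j) => [->|]; rewrite ?mulr1 ?mulr0.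
Qed.

Lemma toC_values_sum (K : realType) (m q : nat) (Q : 'I_q -> {poly K})
    (a : 'I_q -> K) (t : 'cV[K]_m) :
  toC (values (\sum_k a k *: Q k) t) = \sum_k (a k)%:C *: toC (values (Q k) t).
Proof.
apply/matrixP => i j; rewrite !mxE horner_sum rmorph_sum summxE.
by apply: eq_bigr => k _; rewrite !mxE hornerZ rmorphM.
Qed.

(** The columns [1] to [q] of [T], counted from [0], are eigenvectors for the eigenvalue [1];
    linearity extends this to their span. *)
Lemma postproc_values (K : realType) (m q : nat) (star : 'I_m -> bool)
    (T : 'M[K[i]]_m) (Q : 'I_q -> {poly K}) (t : 'cV[K]_m) (r : {poly K}) :
    (q < m)%N -> T \in unitmx ->
    (forall (k : 'I_q) (j : 'I_m), j = k.+1 :> nat ->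
       col j T = toC (values (Q k) t)) ->
    lspan Q r ->
  postproc q star T *m toC (values r t) = toC (values r t).
Proof.
move=> qm uT colT [a ->]; rewrite toC_values_sum mulmx_sumr.
apply: eq_bigr => k _; rewrite -scalemxAr; congr (_ *: _).
have km : (k.+1 < m)%N by rewrite (leq_ltn_trans _ qm).
rewrite -(colT k (Ordinal km) erefl) postproc_eigen// mxE /= ltn_ord.
by rewrite scale1r.
Qed.

Lemma lspan_taylor_poly (K : realType) (k : nat) (f : K -> K) (t : K) :
  lspan (fun j : 'I_k => ('X - t%:P) ^+ j) (taylor_poly k f t).
Proof. by exists (fun j : 'I_k => derive1n j f t / j`!%:R). Qed.

(** [Phi v - w] equals [Phi (v - w - kappa x) + Phi (w - y) - (w - y)]. The direction [x] is meant
    to carry the leading error, and [y] to be a fixed vector close to the exact solution [w]. *)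
Lemma postproc_error (K : realType) (m : nat) (Phi : 'M[K[i]]_m) (M kappa : K)
    (v w x y : 'cV[K]_m) :
    0 <= M -> `|Phi| <= M%:C -> Phi *m toC x = 0 -> Phi *m toC y = toC y ->
  `|Phi *m toC v - toC w| <=
    (m%:R * M * (`|v - w - kappa *: x| + `|w - y|) + `|w - y|)%:C.
Proof.
move=> M0 PM Px Py.
have Phi_le (z : 'cV[K]_m) : `|Phi *m toC z| <= (m%:R * M * `|z|)%:C.
  rewrite (le_trans (mulmx_norm_le _ _))// 2!rmorphM rmorph_nat /=.
  by rewrite ler_pM ?mulr_ge0 ?ler_wpM2l ?toC_norm_le.
have -> : Phi *m toC v - toC w =
    Phi *m toC (v - w - kappa *: x) + Phi *m toC (w - y) - toC (w - y).
  rewrite /toC !map_mxB map_mxZ !mulmxBr -scalemxAr -!/(toC _) Px Py scaler0.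
  by rewrite subr0 opprB [X in _ = X + _]addrA !(addrA, subrK).
rewrite mulrDr !rmorphD /= (le_trans (ler_normB _ _))// lerD ?toC_norm_le//.
by rewrite (le_trans (ler_normD _ _))// lerD.
Qed.

(** * Local truncation error *)

Lemma stage_expansion (K : realType) (k m : nat) (g : K -> K) (x y B t dt : K)
    (w : 'cV[K]_m) :
    (forall j z, (j < k)%N -> z \in `[x, y] -> derivable (derive1n j g) z 1) ->
    (forall z, z \in `[x, y] -> `|derive1n k g z| <= B) ->
    t \in `[x, y] -> (forall i, t + w i 0 * dt \in `[x, y]) ->
  `|map_mx (fun z => g (t + z * dt)) w
    - \sum_(j < k) (dt ^+ j * (derive1n j g t / j`!%:R)) *: cpow w j|
  <= B * (`|w| * `|dt|) ^+ k.
Proof.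
move=> dg gB txy wxy.
have B0 : 0 <= B by apply: le_trans (gB _ txy).
apply: mx_norm_le => [|i l]; first by rewrite mulr_ge0// exprn_ge0// mulr_ge0.
rewrite ord1 !mxE summxE.
have := taylor_poly_error dg gB (wxy i) txy.
rewrite horner_taylor_poly (addrC t) addrK.
rewrite (_ : \sum_(j < k) derive1n j g t / j`!%:R * (w i 0 * dt) ^+ j =
    \sum_(j < k) ((dt ^+ j * (derive1n j g t / j`!%:R)) *: cpow w j) i 0).
  move=> /le_trans; apply; rewrite ler_wpM2l// lerXn2r ?nnegrE ?mulr_ge0//.
  by rewrite normrM ler_wpM2r// mx_norm_entry_le.
by apply: eq_bigr => j _; rewrite !mxE exprMn; ring.
Qed.

(** Here [d j] stands for the [j]-th derivative of [u]; [A] and [R] act on [F(u) = u'], hence the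
    shift to [d j.+1]. The terms of order zero cancel because [D] fixes the vector of ones, and
    collecting powers of [dt] gives the vectors [tau]. *)
Lemma tau_sum (K : realType) (s q : nat) (D A R : 'M[K]_s) (c : 'cV[K]_s)
    (d : nat -> K) (dt : K) : D *m ones K s = ones K s ->
  D *m (\sum_(j < q.+1) (dt ^+ j * (d j / j`!%:R)) *: cpow (c - ones K s) j)
  + dt *: (A *m \sum_(j < q) (dt ^+ j * (d j.+1 / j`!%:R))
                               *: cpow (c - ones K s) j)
  - (\sum_(j < q.+1) (dt ^+ j * (d j / j`!%:R)) *: cpow c j
     - dt *: (R *m \sum_(j < q) (dt ^+ j * (d j.+1 / j`!%:R)) *: cpow c j))
  = \sum_(j < q) (dt ^+ j.+1 * d j.+1) *: tau D A R c j.+1.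
Proof.
move=> D1.
have cpow0 (v : 'cV[K]_s) : cpow v 0 = ones K s by apply/matrixP => i j; rewrite !mxE.
rewrite !big_ord_recl !cpow0 mulmxDr -scalemxAr D1.
set X := _ *: ones K s.
have cancelX (a b e f : 'cV[K]_s) : X + a + b - (X + e - f) = a + b - (e - f).
  by rewrite -(addrA X a) -(addrA X e) opprD addrACA subrr add0r.
rewrite cancelX.
rewrite !mulmx_sumr !scaler_sumr -big_split -!sumrB /=; apply: eq_bigr => j _.
rewrite /bump leq0n add1n /tau -!scalemxAr !scalerA.
apply/matrixP => i l; rewrite !mxE factS natrM exprS.
rewrite [j.+1.-1]/=; field.
by rewrite pnatr_eq0 -lt0n fact_gt0 andbT nat1r pnatr_eq0.
Qed.

(** The defect left when the exact solution is inserted into the scheme. *)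
Definition residual (K : realType) (s : nat) (D A R : 'M[K]_s) (c : 'cV[K]_s)
    (F u : K -> K) (t0 dt : K) (n : nat) : 'cV[K]_s :=
  explicit_map D A F dt (exact_vec u t0 dt c n)
  - implicit_map R F dt (exact_vec u t0 dt c n.+1).

(** All stages are expanded at the newer time [t_(n+1)], seen from which the abscissas of step [n]
    become [c - 1]. By [tau_sum] the Taylor parts combine into [tau_j] terms, of which only those
    with [j = p+1] and [j = p+2] survive. *)
Lemma residual_bound (K : realType) (s p : nat) (D A R : 'M[K]_s)
    (c : 'cV[K]_s) (F u : K -> K) (x y B : K) :
    (forall j z, (j < p.+3)%N -> z \in `[x, y] -> derivable (derive1n j u) z 1) ->
    (forall z, z \in `[x, y] -> `|derive1n p.+3 u z| <= B) ->
    (forall z, z \in `[x, y] -> F (u z) = derive1 u z) ->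
    D *m ones K s = ones K s ->
    (forall j, (1 <= j <= p)%N -> tau D A R c j = 0) ->
  exists2 C : K, 0 <= C & forall t0 dt n, 0 < dt ->
    tgrid t0 dt n.+1 \in `[x, y] ->
    (forall i, stages t0 dt c n i 0 \in `[x, y]) ->
    (forall i, stages t0 dt c n.+1 i 0 \in `[x, y]) ->
    `|residual D A R c F u t0 dt n
      - (dt ^+ p.+1 *: trunc D A R c u t0 dt n.+1 p.+1
         + dt ^+ p.+2 *: trunc D A R c u t0 dt n.+1 p.+2)| <= C * dt ^+ p.+3.
Proof.
move=> du uB ode D1 tau0.
have du' j z : (j < p.+2)%N -> z \in `[x, y] -> derivable (derive1n j (derive1 u)) z 1.
  by move=> jp zxy; rewrite -derive1Sn; exact: du.
have uB' z : z \in `[x, y] -> `|derive1n p.+2 (derive1 u) z| <= B.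
  by move=> zxy; rewrite -derive1Sn; exact: uB.
pose w := c - ones K s.
(* One summand per Taylor remainder. Those of [u'] need one order less, as a factor [dt] multiplies
   them. The absolute value of [B] keeps the constant nonnegative even when the segment is empty. *)
exists (s%:R * `|D| * (`|B| * `|w| ^+ p.+3) + s%:R * `|A| * (`|B| * `|w| ^+ p.+2)
    + (`|B| * `|c| ^+ p.+3 + s%:R * `|R| * (`|B| * `|c| ^+ p.+2))).
  by rewrite !addr_ge0// !mulr_ge0// exprn_ge0.
move=> t0 dt n dt0 txy stn stn1.
set t := tgrid t0 dt n.+1 in txy.
have wE i : t + w i 0 * dt = stages t0 dt c n i 0.
  rewrite /t /w /tgrid !mxE -[n.+1%:R]natr1 /tgrid; ring.
have cE i : t + c i 0 * dt = stages t0 dt c n.+1 i 0 by rewrite !mxE.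
have wxy i : t + w i 0 * dt \in `[x, y] by rewrite wE.
have cxy i : t + c i 0 * dt \in `[x, y] by rewrite cE.
have UnE : exact_vec u t0 dt c n = map_mx (fun z => u (t + z * dt)) w.
  by apply/matrixP => i j; rewrite ord1 [RHS]mxE wE mxE.
have US : exact_vec u t0 dt c n.+1 = map_mx (fun z => u (t + z * dt)) c.
  by apply/matrixP => i j; rewrite ord1 [RHS]mxE cE mxE.
have FUn : map_mx F (exact_vec u t0 dt c n) =
    map_mx (fun z => derive1 u (t + z * dt)) w.
  by rewrite UnE; apply/matrixP => i j; rewrite ord1 [RHS]mxE -ode// mxE [in LHS]mxE.
have FUS : map_mx F (exact_vec u t0 dt c n.+1) =
    map_mx (fun z => derive1 u (t + z * dt)) c.
  by rewrite US; apply/matrixP => i j; rewrite ord1 [RHS]mxE -ode// mxE [in LHS]mxE.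
have main : dt ^+ p.+1 *: trunc D A R c u t0 dt n.+1 p.+1
    + dt ^+ p.+2 *: trunc D A R c u t0 dt n.+1 p.+2 =
    \sum_(j < p.+2) (dt ^+ j.+1 * derive1n j.+1 u t) *: tau D A R c j.+1.
  rewrite 2!big_ord_recr big1 => [|j _]; last by rewrite tau0 ?scaler0//= ltn_ord.
  by rewrite /= add0r /trunc !scalerA.
rewrite main -(tau_sum p.+2 A R c (fun j => derive1n j u t) dt D1).
have := stage_expansion du' uB' txy cxy.
have := stage_expansion du uB txy cxy.
have := stage_expansion du' uB' txy wxy.
have := stage_expansion du uB txy wxy.
rewrite /residual /explicit_map /implicit_map FUn FUS UnE US -/w.
rewrite (gtr0_norm dt0).
under [X in _ -> `|_ - X| <= _ -> _ -> _]eq_bigr => j _ do rewrite -derive1Sn.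
under [X in _ -> _ -> _ -> `|_ - X| <= _ -> _]eq_bigr => j _ do rewrite -derive1Sn.
set Sw := \sum_(j < p.+3) _; set Sw' := \sum_(j < p.+2) _.
set Sc := \sum_(j < p.+3) _; set Sc' := \sum_(j < p.+2) _.
set Uw := map_mx _ w; set Uw' := map_mx _ w.
set Uc := map_mx _ c; set Uc' := map_mx _ c.
move=> eUw eUw' eUc eUc'.
have -> : D *m Uw + dt *: (A *m Uw') - (Uc - dt *: (R *m Uc'))
    - (D *m Sw + dt *: (A *m Sw') - (Sc - dt *: (R *m Sc'))) =
    D *m (Uw - Sw) + dt *: (A *m (Uw' - Sw'))
    - ((Uc - Sc) - dt *: (R *m (Uc' - Sc'))).
  rewrite !mulmxBr; apply/matrixP => i j; rewrite !mxE; ring.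
have Bdt (v : 'cV[K]_s) k : B * (`|v| * dt) ^+ k <= `|B| * `|v| ^+ k * dt ^+ k.
  rewrite exprMn mulrA; apply: ler_wpM2r; first by rewrite exprn_ge0// ltW.
  by apply: ler_wpM2r; [exact: exprn_ge0 | exact: ler_norm].
have mul_le (M : 'M[K]_s) (v : 'cV[K]_s) (r : K) : `|v| <= r ->
    `|M *m v| <= s%:R * `|M| * r.
  by move=> vr; rewrite (le_trans (mulmx_norm_le _ _))// ler_wpM2l// mulr_ge0.
have dmul_le (M : 'M[K]_s) (v : 'cV[K]_s) (r : K) : `|v| <= r * dt ^+ p.+2 ->
    `|dt *: (M *m v)| <= s%:R * `|M| * r * dt ^+ p.+3.
  move=> vr; rewrite normrZ gtr0_norm// (exprS dt p.+2) mulrCA ler_pM2l//.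
  by rewrite -(mulrA _ _ (dt ^+ _)); exact: mul_le.
rewrite (mulrDl _ _ (dt ^+ p.+3)) (le_trans (ler_normB _ _))// lerD//.
  rewrite (mulrDl _ _ (dt ^+ p.+3)) (le_trans (ler_normD _ _))// lerD//.
    by rewrite -(mulrA _ _ (dt ^+ _)); apply: mul_le; exact: le_trans (Bdt _ _).
  by apply: dmul_le; exact: le_trans (Bdt _ _).
rewrite (mulrDl _ _ (dt ^+ p.+3)) (le_trans (ler_normB _ _))// lerD//.
  exact: le_trans (Bdt _ _).
by apply: dmul_le; exact: le_trans (Bdt _ _).
Qed.

(** * Linearisation of [F] and one step of the error *)

(** Two mean values: [F y - F x] has slope [F'(xi)] with [xi] within [|y - x|] of [x], and replacing
    that slope by [F'(z)] costs [B |xi - z|]. *)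
Lemma linearization (K : realType) (F : K -> K) (lo hi B x y z : K) :
    (forall t, t \in `[lo, hi] -> derivable F t 1) ->
    (forall t, t \in `[lo, hi] -> derivable (derive1 F) t 1) ->
    (forall t, t \in `[lo, hi] -> `|derive1n 2 F t| <= B) ->
    x \in `[lo, hi] -> y \in `[lo, hi] -> z \in `[lo, hi] ->
  `|F y - F x - derive1 F z * (y - x)| <= B * (`|x - z| + `|y - x|) * `|y - x|.
Proof.
move=> dF ddF FB xI yI zI.
have B0 : 0 <= B by apply: le_trans (FB _ xI).
have [xi [xiI xix _ ->]] := mvt_between dF yI xI.
rewrite -mulrBl normrM ler_wpM2r//.
have [eta [etaI _ _ ->]] := mvt_between ddF xiI zI.
rewrite normrM ler_pM//; first exact: FB.
by rewrite [leRHS]addrC -(subrKA x) (le_trans (ler_normD _ _))// lerD2r.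
Qed.

(** One slope [F'(z)] serves all components. Being a scalar, it commutes with [A] and [R], which
    lets the condition on [D *m (A + R)] act on the leading error; [delta] is the price. *)
Lemma map_mx_linearization (K : realType) (s : nat) (F : K -> K)
    (lo hi B z delta : K) (U V : 'cV[K]_s) :
    (forall t, t \in `[lo, hi] -> derivable F t 1) ->
    (forall t, t \in `[lo, hi] -> derivable (derive1 F) t 1) ->
    (forall t, t \in `[lo, hi] -> `|derive1n 2 F t| <= B) ->
    0 <= delta -> z \in `[lo, hi] ->
    (forall i, U i 0 \in `[lo, hi]) -> (forall i, V i 0 \in `[lo, hi]) ->
    (forall i, `|U i 0 - z| <= delta) ->
  `|map_mx F V - map_mx F U - derive1 F z *: (V - U)|
    <= B * (delta + `|V - U|) * `|V - U|.
Proof.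
move=> dF ddF FB delta0 zI UI VI Uz.
have B0 : 0 <= B by apply: le_trans (FB _ zI).
apply: mx_norm_le => [|i j]; first by rewrite !mulr_ge0// addr_ge0.
have entry : `|V i 0 - U i 0| <= `|V - U|.
  by rewrite (le_trans _ (mx_norm_entry_le _ i 0))// !mxE.
rewrite ord1 !mxE (le_trans (linearization dF ddF FB _ _ zI))//.
by rewrite ler_pM ?mulr_ge0 ?addr_ge0// ler_wpM2l// lerD.
Qed.

(* The defect is measured against [h ^+ p.+1 *: d *: t1], with [t1] in the kernel
   of [D]. The terms of order [p + 2] drop out of the [D]-component, up to the
   variation of [d] over one step. *)
Lemma error_step (K : realType) (s p : nat) (D A R : 'M[K]_s)
    (t1 t2 E E' r1 r2 rho : 'cV[K]_s) (kappa d d' d2 Q h : K) :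
    D *m D = D -> D *m t1 = 0 -> D *m t2 = 0 -> D *m (A + R) *m t1 = 0 ->
    E' = D *m E + h *: (A *m (kappa *: E + r1)) + h *: (R *m (kappa *: E' + r2))
         + (h ^+ p.+1 *: (d' *: t1) + h ^+ p.+2 *: (d2 *: t2) + rho) ->
    1 <= Q -> s%:R * `|D| <= Q -> s%:R * `|A| <= Q -> s%:R * `|R| <= Q ->
    `|t1| <= Q -> `|t2| <= Q -> `|kappa| <= Q -> `|d| <= Q -> `|d'| <= Q ->
    `|d2| <= Q -> `|d - d'| <= Q * h -> 0 < h -> h <= 1 ->
    `|r1| <= Q * (Q * h + `|E|) * `|E| ->
    `|r2| <= Q * (Q * h + `|E'|) * `|E'| ->
    `|rho| <= Q * h ^+ p.+3 -> `|E| <= 1 -> `|E'| <= 1 ->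
  let e := E - h ^+ p.+1 *: (d *: t1) in
  let e' := E' - h ^+ p.+1 *: (d' *: t1) in
  `|e'| <= `|D *m e| + 8 * Q ^+ 8 * h ^+ p.+2
           + 8 * Q ^+ 8 * h * (`|e| + `|e'|) /\
  `|D *m e'| <= `|D *m e| + 8 * Q ^+ 8 * h ^+ p.+3
           + 8 * Q ^+ 8 * h * (`|e| + `|e'|).
Proof.
move=> DD Dt1 Dt2 DARt EE Q1 DQ AQ RQ t1Q t2Q kQ dQ d'Q d2Q ddQ h0 h1.
move=> r1Q r2Q rhoQ E1 E1' e e'.
have h0' := ltW h0.
have Q0 : 0 <= Q by exact: le_trans Q1.
have Qk (k l : nat) : (k <= l)%N -> Q ^+ k <= Q ^+ l by move=> kl; exact: ler_weXn2l.
have Qg k : 0 <= Q ^+ k by exact: exprn_ge0.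
have hg k : 0 <= h ^+ k by exact: exprn_ge0.
have mulQ (M : 'M[K]_s) (v : 'cV[K]_s) : s%:R * `|M| <= Q -> `|M *m v| <= Q * `|v|.
  by move=> MQ; rewrite (le_trans (mulmx_norm_le _ _))// ler_wpM2r.
(* Since [v] is [O(h^(p+1))] plus a vector of norm [b], and [|v| <= 1], the quadratic remainder is
   [O(h^(p+2))] plus a multiple of [b]. The factor [h] before [A] and [R] later turns this into
   [h b]. *)
have quad (v w : 'cV[K]_s) (f : K) : `|f| <= Q -> `|v| <= 1 ->
    `|w| <= Q * (Q * h + `|v|) * `|v| ->
    `|w| <= 2 * Q ^+ 6 * h ^+ p.+2 + 3 * Q ^+ 4 * `|v - h ^+ p.+1 *: (f *: t1)|.
  move=> fQ v1 /le_trans; apply.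
  set b := `|v - _|; have b0 : 0 <= b by exact: normr_ge0.
  have gQ : `|h ^+ p.+1 *: (f *: t1)| <= Q ^+ 2 * h ^+ p.+1.
    rewrite !normrZ ger0_norm// mulrC ler_wpM2r//.
    by rewrite expr2 ler_pM.
  have vb : `|v| <= Q ^+ 2 * h ^+ p.+1 + b.
    by have := lerB_dist v (h ^+ p.+1 *: (f *: t1)); rewrite -/b; lra.
  have Hh : h ^+ p.+1 <= h by rewrite exprS ler_piMr// exprn_ile1.
  rewrite (exprS h p.+1); set H := h ^+ p.+1 in vb Hh *.
  have H0 : 0 <= H by exact: hg.
  set e0 := `|v| in v1 vb *; have e00 : 0 <= e0 by exact: normr_ge0.
  have he : h * e0 <= Q ^+ 2 * (h * H) + b.
    have : h * e0 <= h * (Q ^+ 2 * H + b) by rewrite ler_wpM2l.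
    have : h * b <= b by rewrite ler_piMl.
    by lra.
  have He : H * e0 <= Q ^+ 2 * (h * H) + b.
    have : H * e0 <= H * (Q ^+ 2 * H + b) by rewrite ler_wpM2l.
    have : H * b <= b by rewrite ler_piMl// (le_trans Hh).
    have : Q ^+ 2 * (H * H) <= Q ^+ 2 * (h * H) by rewrite ler_wpM2l// ler_wpM2r.
    by lra.
  have ee : e0 * e0 <= Q ^+ 2 * (Q ^+ 2 * (h * H) + b) + b.
    have : e0 * e0 <= e0 * (Q ^+ 2 * H + b) by rewrite ler_wpM2l.
    have : e0 * b <= b by rewrite ler_piMl.
    have : Q ^+ 2 * (H * e0) <= Q ^+ 2 * (Q ^+ 2 * (h * H) + b) by rewrite ler_wpM2l.
    by lra.
  have hH0 : 0 <= h * H by rewrite mulr_ge0.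
  have eeQ : Q * (e0 * e0) <= Q ^+ 2 * (e0 * e0).
    by rewrite ler_wpM2r ?mulr_ge0// expr2 ler_peMl.
  have : Q ^+ 2 * (h * e0 + e0 * e0) <=
      Q ^+ 2 * (Q ^+ 2 * (h * H) + b + (Q ^+ 2 * (Q ^+ 2 * (h * H) + b) + b)).
    by rewrite ler_wpM2l// lerD.
  have : Q ^+ 4 * (h * H) <= Q ^+ 6 * (h * H) by rewrite ler_wpM2r// Qk.
  have : Q ^+ 2 * b <= Q ^+ 4 * b by rewrite ler_wpM2r// Qk.
  by lra.
(* [X] gathers the terms of size [O(h^(p+3) + h (|e| + |e'|))]; [Y] is the coefficient of
   [h ^+ p.+2], from the leading parts of [E] and [E'] and from [t2]. *)
pose X := h *: (kappa *: (A *m e)) + h *: (kappa *: (R *m e'))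
  + h *: (A *m r1) + h *: (R *m r2) + rho.
pose Y := (kappa * d) *: (A *m t1) + (kappa * d') *: (R *m t1) + d2 *: t2.
have e'E : e' = D *m e + X + h ^+ p.+2 *: Y.
  rewrite {1}/e' {1}EE /X /Y /e /e' !mulmxDr !mulmxN -!scalemxAr Dt1 !scaler0 subr0.
  by apply/matrixP => i j; rewrite !mxE (exprS h p.+1); ring.
have De'E : D *m e' = D *m e + D *m X
    + h ^+ p.+2 *: ((kappa * (d - d')) *: (D *m (A *m t1))).
  rewrite e'E 2!mulmxDr mulmxA DD; congr (_ + _ + _).
  rewrite -scalemxAr; congr (_ *: _); rewrite /Y 2!mulmxDr -!scalemxAr Dt2 scaler0 addr0.
  (* The condition on [D *m (A + R)] turns the sum of the two contributions of [t1] into one with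
     the factor [d - d'], which is [O(h)] and so gains one order. *)
  have -> : D *m (R *m t1) = - (D *m (A *m t1)).
    by apply/eqP; rewrite -addr_eq0 -mulmxDr -mulmxDl addrC mulmxA DARt.
  by rewrite scalerN -scalerBl mulrBr.
set b := `|e|; set b' := `|e'|.
have b0 : 0 <= b by exact: normr_ge0.
have b'0 : 0 <= b' by exact: normr_ge0.
have r1b := quad _ _ _ dQ E1 r1Q; have r2b := quad _ _ _ d'Q E1' r2Q.
rewrite -/e -/e' -/b -/b' in r1b r2b.
have XZ : `|X| <= 5 * Q ^+ 7 * (h ^+ p.+3 + h * (b + b')).
  have kMb (M : 'M[K]_s) (v : 'cV[K]_s) : s%:R * `|M| <= Q ->
      `|h *: (kappa *: (M *m v))| <= Q ^+ 2 * (h * `|v|).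
    move=> MQ; rewrite !normrZ gtr0_norm// [leRHS]mulrCA ler_pM2l// expr2 -mulrA.
    by rewrite ler_pM// mulQ.
  have rMb (M : 'M[K]_s) (v : 'cV[K]_s) (f : K) : s%:R * `|M| <= Q ->
      `|v| <= 2 * Q ^+ 6 * h ^+ p.+2 + 3 * Q ^+ 4 * f ->
      `|h *: (M *m v)| <= 2 * Q ^+ 7 * h ^+ p.+3 + 3 * Q ^+ 5 * (h * f).
    move=> MQ vf; rewrite normrZ gtr0_norm//.
    have : h * `|M *m v| <= h * (Q * (2 * Q ^+ 6 * h ^+ p.+2 + 3 * Q ^+ 4 * f)).
      by rewrite ler_pM2l// (le_trans (mulQ _ _ MQ))// ler_wpM2l.
    by rewrite (exprS h p.+2); lra.
  have := kMb _ e AQ; have := kMb _ e' RQ.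
  have := rMb _ _ _ AQ r1b; have := rMb _ _ _ RQ r2b.
  rewrite -/b -/b'.
  have hb : 0 <= h * b by rewrite mulr_ge0.
  have hb' : 0 <= h * b' by rewrite mulr_ge0.
  have : Q * h ^+ p.+3 <= Q ^+ 7 * h ^+ p.+3.
    by rewrite ler_wpM2r// -[leLHS]expr1 Qk.
  have : Q ^+ 2 * (h * b) <= Q ^+ 7 * (h * b) by rewrite ler_wpM2r// Qk.
  have : Q ^+ 2 * (h * b') <= Q ^+ 7 * (h * b') by rewrite ler_wpM2r// Qk.
  have : Q ^+ 5 * (h * b) <= Q ^+ 7 * (h * b) by rewrite ler_wpM2r// Qk.
  have : Q ^+ 5 * (h * b') <= Q ^+ 7 * (h * b') by rewrite ler_wpM2r// Qk.
  have : 0 <= Q ^+ 7 * (h * b) by rewrite mulr_ge0.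
  have : 0 <= Q ^+ 7 * (h * b') by rewrite mulr_ge0.
  have : `|X| <= `|h *: (kappa *: (A *m e))| + `|h *: (kappa *: (R *m e'))|
      + `|h *: (A *m r1)| + `|h *: (R *m r2)| + `|rho|.
    by rewrite /X; do 4![apply: (le_trans (ler_normD _ _)); apply: lerD => //].
  by move: rhoQ; lra.
have YQ : `|Y| <= 3 * Q ^+ 4.
  have kMb (M : 'M[K]_s) (f : K) : s%:R * `|M| <= Q -> `|f| <= Q ->
      `|(kappa * f) *: (M *m t1)| <= Q ^+ 4.
    move=> MQ fQ; rewrite normrZ normrM.
    have -> : Q ^+ 4 = (Q * Q) * (Q * Q) by ring.
    by rewrite !ler_pM// (le_trans (mulQ _ _ MQ))// ler_wpM2l.
  have := kMb _ _ AQ dQ; have := kMb _ _ RQ d'Q.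
  have : `|d2 *: t2| <= Q ^+ 2 by rewrite normrZ expr2 ler_pM.
  have : Q ^+ 2 <= Q ^+ 4 by exact: Qk.
  have : `|Y| <= `|(kappa * d) *: (A *m t1)| + `|(kappa * d') *: (R *m t1)|
      + `|d2 *: t2|.
    by rewrite /Y; do 2![apply: (le_trans (ler_normD _ _)); apply: lerD => //].
  by lra.
have Z0 : 0 <= h * (b + b') by rewrite mulr_ge0// addr_ge0.
(* In the first bound [8 = 5 + 3], from [XZ] and [YQ]. In the second, [D] costs one more factor [Q]
   on [X], while [D] applied to the [Y] term leaves only a term of order [h^(p+3)]. *)
split.
  have : Q ^+ 7 * (h ^+ p.+3 + h * (b + b')) <=
      Q ^+ 8 * (h ^+ p.+2 + h * (b + b')).
    apply: ler_pM; rewrite ?addr_ge0// ?Qk// lerD2r.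
    by rewrite (exprS h p.+2) ler_piMl.
  have : h ^+ p.+2 * `|Y| <= h ^+ p.+2 * (3 * Q ^+ 4) by rewrite ler_wpM2l.
  have : h ^+ p.+2 * Q ^+ 4 <= h ^+ p.+2 * Q ^+ 8 by rewrite ler_wpM2l// Qk.
  have : 0 <= Q ^+ 8 * (h * (b + b')) by rewrite mulr_ge0.
  have : `|e'| <= `|D *m e| + `|X| + h ^+ p.+2 * `|Y|.
    rewrite e'E (le_trans (ler_normD _ _))// lerD ?ler_normD//.
    by rewrite normrZ ger0_norm.
  by rewrite -/b'; lra.
have : `|D *m X| <= Q * (5 * Q ^+ 7 * (h ^+ p.+3 + h * (b + b'))).
  by rewrite (le_trans (mulQ _ _ DQ))// ler_wpM2l.
have : `|h ^+ p.+2 *: ((kappa * (d - d')) *: (D *m (A *m t1)))| <=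
    h ^+ p.+2 * ((Q * (Q * h)) * (Q * (Q * Q))).
  rewrite normrZ (ger0_norm (hg _)) (normrZ (kappa * _)) (normrM kappa).
  rewrite ler_wpM2l//.
  apply: ler_pM; rewrite ?mulr_ge0//; first by rewrite ler_pM.
  rewrite (le_trans (mulQ _ _ DQ))// ler_wpM2l//.
  by rewrite (le_trans (mulQ _ _ AQ))// ler_wpM2l.
have -> : h ^+ p.+2 * ((Q * (Q * h)) * (Q * (Q * Q))) = Q ^+ 5 * h ^+ p.+3.
  by rewrite (exprS h p.+2); ring.
have : Q ^+ 5 * h ^+ p.+3 <= Q ^+ 8 * h ^+ p.+3 by rewrite ler_wpM2r// Qk.
have : 0 <= Q ^+ 8 * (h * (b + b')) by rewrite mulr_ge0.
have : 0 <= Q ^+ 8 * h ^+ p.+3 by rewrite mulr_ge0.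
have : `|D *m e'| <= `|D *m e| + `|D *m X|
    + `|h ^+ p.+2 *: ((kappa * (d - d')) *: (D *m (A *m t1)))|.
  by rewrite De'E (le_trans (ler_normD _ _))// lerD ?ler_normD.
by lra.
Qed.

(** * Propagation of the global error *)

Definition global_error (K : realType) (s : nat) (c : 'cV[K]_s) (u : K -> K)
    (t0 dt : K) (V : nat -> 'cV[K]_s) (n : nat) : 'cV[K]_s :=
  V n - exact_vec u t0 dt c n.

Lemma tgrid_le (K : realType) (t0 dt : K) (k n : nat) :
  0 <= dt -> (k <= n)%N -> tgrid t0 dt k <= tgrid t0 dt n.
Proof. by move=> dt0 kn; rewrite lerD2l ler_wpM2r// ler_nat. Qed.

(** The abscissas are nonpositive, so stages never pass the grid time; the first ones may lie before
    [t0], by at most [dt * |c|], and [lo] leaves room for that. *)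
Lemma stages_in (K : realType) (s : nat) (t0 tend lo dt : K) (c : 'cV[K]_s)
    (n : nat) : 0 <= dt -> (forall i, c i 0 <= 0) ->
    dt * `|c| <= t0 - lo -> tgrid t0 dt n <= tend ->
  tgrid t0 dt n \in `[lo, tend] /\
  forall i, stages t0 dt c n i 0 \in `[lo, tend].
Proof.
move=> dt0 c0 dtc tn.
have t0n : t0 <= tgrid t0 dt n by rewrite lerDl mulr_ge0.
have dtc0 : 0 <= dt * `|c| by rewrite mulr_ge0.
split=> [|i]; first by rewrite in_itv /= tn andbT; lra.
rewrite !mxE in_itv /=.
have cdt : c i 0 * dt <= 0 by rewrite mulr_le0_ge0.
have : `|c i 0| * dt <= `|c| * dt by rewrite ler_wpM2r// mx_norm_entry_le.
rewrite ler0_norm// mulNr (mulrC `|c|) => cdt'.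
by apply/andP; split; lra.
Qed.

Lemma abscissas_le0 (K : realType) (s : nat) (c : 'cV[K]_s) :
    (forall i j : 'I_s, (i <= j)%N -> c i 0 <= c j 0) ->
    (forall i : 'I_s, i.+1 = s -> c i 0 = 0) ->
  forall i, c i 0 <= 0.
Proof.
case: s c => [|s] c mono last0 i; first by case: i.
by rewrite -(last0 ord_max erefl) mono// -ltnS.
Qed.

(** An instance of [error_step] in which [d] and [d'] are the values of the derivative of order
    [p+1] of [u] at the two times. The constant is uniform in [dt], [n] and [V]. *)
Lemma global_error_step (K : realType) (s p : nat) (D A R : 'M[K]_s)
    (c : 'cV[K]_s) (F u : K -> K) (t0 lo tend B BF Cres : K) :
    D *m D = D -> (forall i, c i 0 <= 0) ->
    D *m tau D A R c p.+1 = 0 -> D *m tau D A R c p.+2 = 0 ->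
    D *m (A + R) *m tau D A R c p.+1 = 0 ->
    (forall j z, (j <= p.+1)%N -> z \in `[lo, tend] -> derivable (derive1n j u) z 1) ->
    (forall j z, (j <= p.+2)%N -> z \in `[lo, tend] -> `|derive1n j u z| <= B) ->
    (forall z, derivable F z 1) -> (forall z, derivable (derive1 F) z 1) ->
    (forall j z, (j <= 2)%N -> z \in `[- (B + 1), B + 1] -> `|derive1n j F z| <= BF) ->
    0 <= B -> 0 <= BF -> 0 <= Cres ->
  exists2 Q : K, 0 <= Q & forall (dt : K) (V : nat -> 'cV[K]_s) (n : nat),
    0 < dt -> dt <= 1 -> dt * `|c| <= t0 - lo -> tgrid t0 dt n.+1 <= tend ->
    V n.+1 = D *m V n + dt *: (A *m map_mx F (V n))
             + dt *: (R *m map_mx F (V n.+1)) ->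
    `|residual D A R c F u t0 dt n
      - (dt ^+ p.+1 *: trunc D A R c u t0 dt n.+1 p.+1
         + dt ^+ p.+2 *: trunc D A R c u t0 dt n.+1 p.+2)| <= Cres * dt ^+ p.+3 ->
    let E := global_error c u t0 dt V in
    let e k := E k - dt ^+ p.+1 *: trunc D A R c u t0 dt k p.+1 in
    `|E n| <= 1 -> `|E n.+1| <= 1 ->
    `|e n.+1| <= `|D *m e n| + Q * dt ^+ p.+2 + Q * dt * (`|e n| + `|e n.+1|) /\
    `|D *m e n.+1| <= `|D *m e n| + Q * dt ^+ p.+3
                      + Q * dt * (`|e n| + `|e n.+1|).
Proof.
move=> DD c0 Dt1 Dt2 DARt du uB dF ddF FB B0 BF0 Cres0.
pose t1 := tau D A R c p.+1; pose t2 := tau D A R c p.+2.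
pose Q := 1 + s%:R * `|D| + s%:R * `|A| + s%:R * `|R| + `|t1| + `|t2| + B + BF
  + B * (1 + `|c|) + Cres.
have sM0 (M : 'M[K]_s) : 0 <= s%:R * `|M| by rewrite mulr_ge0.
have Bc0 : 0 <= B * (1 + `|c|) by rewrite mulr_ge0// addr_ge0.
have QE : [/\ 1 <= Q, s%:R * `|D| <= Q, s%:R * `|A| <= Q & s%:R * `|R| <= Q] /\
    [/\ `|t1| <= Q, `|t2| <= Q, B <= Q & BF <= Q] /\
    (B * (1 + `|c|) <= Q /\ Cres <= Q).
  have := sM0 D; have := sM0 A; have := sM0 R.
  have := normr_ge0 t1; have := normr_ge0 t2.
  by rewrite /Q => *; do !split; lra.
case: QE => -[Q1 DQ AQ RQ] [[t1Q t2Q BQ BFQ] [BcQ CresQ]].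
have Q0 : 0 <= Q by exact: le_trans Q1.
exists (8 * Q ^+ 8); first by rewrite mulr_ge0// exprn_ge0.
move=> dt V n dt0 dt1 dtc tn1 scheme res E e En1 En11.
have dt0' := ltW dt0.
have tn : tgrid t0 dt n <= tend.
  by apply: le_trans tn1; exact: tgrid_le.
have [tnI stI] := stages_in dt0' c0 dtc tn.
have [tn1I st1I] := stages_in dt0' c0 dtc tn1.
have uI z : z \in `[lo, tend] -> u z \in `[- (B + 1), B + 1].
  move=> zI; rewrite in_itv /= -ler_norml (le_trans (uB 0%N _ _ zI))//.
  by rewrite lerDl.
have mvtu j z w : (j <= p.+1)%N -> z \in `[lo, tend] -> w \in `[lo, tend] ->
    `|derive1n j u z - derive1n j u w| <= B * `|z - w|.
  move=> jp zI wI.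
  have [xi [xiI _ _ ->]] := mvt_between (fun z => @du j z jp) zI wI.
  by rewrite normrM ler_wpM2r// -derive1nS uB.
pose tnn := tgrid t0 dt n.
(* The slope at time [t_n] is used for both steps, so that [A] and [R] receive the same factor. *)
pose kappa := derive1 F (u tnn).
have tn1E : tgrid t0 dt n.+1 = tnn + dt by rewrite /tnn /tgrid -natr1; ring.
(* An error of at most [1] keeps the numerical values where the derivatives of [F] are bounded by
   [BF]. *)
have VI k : (forall i, stages t0 dt c k i 0 \in `[lo, tend]) -> `|E k| <= 1 ->
    forall i, V k i 0 \in `[- (B + 1), B + 1].
  move=> skI Ek i; rewrite in_itv /= -ler_norml.
  have -> : V k i 0 = exact_vec u t0 dt c k i 0 + E k i 0.
    by rewrite /E /global_error !mxE [RHS]addrC subrK.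
  rewrite (le_trans (ler_normD _ _))// lerD//; last first.
    by rewrite (le_trans (mx_norm_entry_le _ _ _)).
  by rewrite mxE; exact: (uB 0%N).
pose delta := B * (1 + `|c|) * dt.
(* The stages of both steps lie within [(1 + |c|) dt] of [t_n]; the newer grid time accounts for the
   [1]. *)
have Udelta k : k = n \/ k = n.+1 ->
    forall i, `|exact_vec u t0 dt c k i 0 - u tnn| <= delta.
  move=> kn i.
  have skI : stages t0 dt c k i 0 \in `[lo, tend] by case: kn => ->.
  rewrite mxE (le_trans (mvtu 0%N _ _ _ skI tnI))// /delta -mulrA ler_wpM2l//.
  have ci : `|c i 0 * dt| <= `|c| * dt.
    by rewrite normrM (gtr0_norm dt0) ler_wpM2r// mx_norm_entry_le.
  rewrite mxE mulrDl mul1r; case: kn => ->.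
    by rewrite -/tnn addrC addKr (le_trans ci)// lerDr.
  rewrite tn1E; have -> : tnn + dt + c i 0 * dt - tnn = dt + c i 0 * dt by ring.
  by rewrite (le_trans (ler_normD _ _))// gtr0_norm// lerD2l.
have delta0 : 0 <= delta by rewrite mulr_ge0.
have lin k : k = n \/ k = n.+1 -> `|E k| <= 1 ->
    `|map_mx F (V k) - map_mx F (exact_vec u t0 dt c k) - kappa *: E k|
      <= Q * (Q * dt + `|E k|) * `|E k|.
  move=> kn Ek.
  have skI : forall i, stages t0 dt c k i 0 \in `[lo, tend] by case: kn => ->.
  have UI i : exact_vec u t0 dt c k i 0 \in `[- (B + 1), B + 1].
    by rewrite mxE; exact: uI.
  rewrite (le_trans (map_mx_linearization (fun z _ => dF z) (fun z _ => ddF z)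
    (fun z => @FB 2 z isT) delta0 (uI _ tnI) UI (VI _ skI Ek) (Udelta _ kn)))//.
  rewrite ler_wpM2r// ler_pM ?addr_ge0// lerD2r /delta ler_wpM2r//.
have eE k : e k = E k - dt ^+ p.+1 *: (derive1n p.+1 u (tgrid t0 dt k) *: t1).
  by [].
rewrite !eE; apply: (error_step (A := A) (R := R) (t2 := t2) (kappa := kappa)
  (r1 := map_mx F (V n) - map_mx F (exact_vec u t0 dt c n) - kappa *: E n)
  (r2 := map_mx F (V n.+1) - map_mx F (exact_vec u t0 dt c n.+1) - kappa *: E n.+1)
  (d2 := derive1n p.+2 u (tgrid t0 dt n.+1))
  (rho := residual D A R c F u t0 dt n
      - (dt ^+ p.+1 *: trunc D A R c u t0 dt n.+1 p.+1
         + dt ^+ p.+2 *: trunc D A R c u t0 dt n.+1 p.+2))) => //.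
(* The error equation is exact: the terms added and subtracted in [r1], [r2] and [rho] cancel,
   leaving the scheme compared with the defect of the exact solution. *)
- rewrite /trunc -/t1 -/t2.
  set Tr := _ *: (_ *: t1) + _ *: (_ *: t2).
  rewrite (addrC Tr) subrK !(addrC (kappa *: _)) !subrK.
  rewrite /residual /explicit_map /implicit_map /E /global_error !mulmxBr.
  rewrite {1}scheme; apply/matrixP => i j; rewrite !mxE; ring.
- by apply: le_trans BFQ; apply: (FB 1%N) => //; exact: uI.
- by apply: le_trans BQ; apply: uB.
- by apply: le_trans BQ; apply: uB.
- by apply: le_trans BQ; apply: uB.
- rewrite (le_trans (mvtu _ _ _ _ tnI tn1I))// tn1E opprD addNKr normrN gtr0_norm//.
  by rewrite ler_wpM2r.
- by apply: lin => //; left.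
- by apply: lin => //; right.
- by rewrite (le_trans res)// ler_wpM2r// exprn_ge0.
Qed.

(** The leading error is the local one of order [p+1], without accumulation over the steps. Its
    direction is therefore known, and the post-processor can remove it. *)
Lemma global_error_expansion (K : realType) (s p : nat) (F u : K -> K)
    (a b t0 tend : K) (D A R : 'M[K]_s) (c : 'cV[K]_s)
    (V : K -> nat -> 'cV[K]_s) :
    (1 <= s)%N -> a < t0 -> tend < b ->
    smooth_on p.+2 F setT -> smooth_on p.+3 u `]a, b[ -> solves_on F u `]a, b[ ->
    (forall i j : 'I_s, (i <= j)%N -> c i 0 <= c j 0) ->
    (forall i : 'I_s, i.+1 = s -> c i 0 = 0) ->
    \rank D = 1%N -> D *m ones K s = ones K s ->
    (forall j, (1 <= j <= p)%N -> tau D A R c j = 0) ->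
    D *m tau D A R c p.+1 = 0 -> D *m tau D A R c p.+2 = 0 ->
    D *m (A + R) *m tau D A R c p.+1 = 0 ->
    (exists M L : K, \forall dt \near 0^'+,
       exists G : 'cV[K]_s -> 'cV[K]_s,
         [/\ cancel (implicit_map R F dt) G,
             cancel G (implicit_map R F dt),
             M.-lipschitz G &
             L.-lipschitz (G \o explicit_map D A F dt)]) ->
    (\forall dt \near 0^'+, forall n, (1 <= n)%N ->
       V dt n.+1 = D *m V dt n + dt *: (A *m map_mx F (V dt n))
                   + dt *: (R *m map_mx F (V dt n.+1))) ->
    (exists C : K, \forall dt \near 0^'+,
       `|(V dt 1%N - exact_vec u t0 dt c 1)
         - (dt ^+ p.+1 *: trunc D A R c u t0 dt 1 p.+1
            + dt ^+ p.+2 *: trunc D A R c u t0 dt 1 p.+2)| <= C * dt ^+ p.+3) ->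
  exists2 C : K, 0 <= C & \forall dt \near 0^'+, forall n, (1 <= n)%N ->
    tgrid t0 dt n <= tend ->
    `|global_error c u t0 dt (V dt) n
      - dt ^+ p.+1 *: trunc D A R c u t0 dt n p.+1| <= C * dt ^+ p.+2.
Proof.
move=> hs hat0 htendb hF hu hode csort clast rD D1 tau0 Dt1 Dt2 DARt.
move=> [M [L hG]] hscheme [Ci hinit].
have c0 := abscissas_le0 csort clast.
have DD : D *m D = D.
  apply: rank1_idempotent rD _ D1; apply/eqP => /matrixP/(_ (Ordinal hs) 0).
  by rewrite !mxE => /eqP; rewrite oner_eq0.
(* A point strictly between [a] and [t0], so that stages before [t0] still lie inside the open
   interval where [u] is smooth. *)
pose lo := (a + t0) / 2.
have lo_t0 : lo < t0 by rewrite /lo; lra.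
have Iab : `[lo, tend] `<=` `]a, b[.
  move=> z /=; rewrite !in_itv /= => /andP[loz ztend].
  by rewrite (le_lt_trans ztend) // (lt_le_trans _ loz)// /lo; lra.
have [B B0 uB] := smooth_on_bounded hu Iab.
have [BF BF0 FB] := smooth_on_bounded hF (@subsetT _ `[- (B + 1), B + 1]).
have du j z : (j < p.+3)%N -> z \in `[lo, tend] -> derivable (derive1n j u) z 1.
  by move=> jp zI; have [+ _] := hu z (Iab z zI); apply.
have ode z : z \in `[lo, tend] -> F (u z) = derive1 u z.
  by move=> zI; have [_ ->] := hode z (Iab z zI).
have dF z : derivable F z 1 := proj1 (hF z I) 0%N isT.
have ddF z : derivable (derive1 F) z 1 := proj1 (hF z I) 1%N isT.
have [Cres Cres0 resB] := residual_bound du (fun z => @uB p.+3 z (leqnn _)) ode D1 tau0.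
have [Q Q0 step] := @global_error_step K s p D A R c F u t0 lo tend B BF Cres
  DD c0 Dt1 Dt2 DARt (fun j z (jp : (j <= p.+1)%N) => du j z (leqW jp))
  (fun j z (jp : (j <= p.+2)%N) => @uB j z (leqW jp)) dF ddF
  (fun j z (jp : (j <= 2)%N) => @FB j z (leq_trans jp (isT : (2 <= p.+2)%N))) B0 BF0 Cres0.
pose T := B * `|tau D A R c p.+1|.
pose T2 := B * `|tau D A R c p.+2|.
have T0 : 0 <= T by rewrite mulr_ge0.
have T20 : 0 <= T2 by rewrite mulr_ge0.
pose L' := `|L| + `|M| * (T + T2 + Cres).
have L'0 : 0 <= L' by rewrite addr_ge0// mulr_ge0// !addr_ge0.
pose B1 := T2 + `|Ci|.
have B10 : 0 <= B1 by rewrite addr_ge0.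
have sD0 : 0 <= 1 + s%:R * `|D| by rewrite addr_ge0// mulr_ge0.
(* The factor [1 + s |D|] lets one initial constant bound both [e 1] and [D *m e 1]. The length of
   the time interval bounds [N dt]; the absolute value covers a [tend] that precedes [t0]. *)
have [K0 [h0 [K00 h00 rec]]] := @error_recursion K p Q L' T
  ((1 + s%:R * `|D|) * B1) `|tend - t0| Q0 L'0 T0 (mulr_ge0 sD0 B10) (normr_ge0 _).
exists K0 => //.
near=> dt.
have dt0 : 0 < dt by near: dt; exact: nbhs_right_gt.
have dt0' := ltW dt0.
have dth0 : dt <= h0 by near: dt; exact: nbhs_right_le.
have dt1 : dt <= 1 by near: dt; exact: nbhs_right_le.
have dtc : dt * `|c| <= t0 - lo.
  have c1 : 0 < 1 + `|c| by rewrite ltr_pwDl.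
  apply: (@le_trans _ _ (dt * (1 + `|c|))); first by rewrite ler_pM2l// lerDr.
  rewrite -ler_pdivlMr//; near: dt; apply: nbhs_right_le.
  by rewrite divr_gt0// subr_gt0.
have schemedt : forall n, (1 <= n)%N ->
     V dt n.+1 = D *m V dt n + dt *: (A *m map_mx F (V dt n))
                 + dt *: (R *m map_mx F (V dt n.+1)).
  by near: dt.
have [G [GK KG GM GL]] : exists G : 'cV[K]_s -> 'cV[K]_s,
         [/\ cancel (implicit_map R F dt) G,
             cancel G (implicit_map R F dt),
             M.-lipschitz G &
             L.-lipschitz (G \o explicit_map D A F dt)].
  by near: dt.
have initdt : `|(V dt 1%N - exact_vec u t0 dt c 1)
         - (dt ^+ p.+1 *: trunc D A R c u t0 dt 1 p.+1
            + dt ^+ p.+2 *: trunc D A R c u t0 dt 1 p.+2)| <= Ci * dt ^+ p.+3.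
  by near: dt.
move=> N N1 tN.
have dtg k : 0 <= dt ^+ k by exact: exprn_ge0.
have tk k : (k <= N)%N -> tgrid t0 dt k <= tend.
  by move=> kN; apply: le_trans tN; exact: tgrid_le.
have kI k : (k <= N)%N -> tgrid t0 dt k \in `[lo, tend] /\
    forall i, stages t0 dt c k i 0 \in `[lo, tend].
  by move=> kN; apply: stages_in => //; exact: tk.
have truncB k j : (k <= N)%N -> (j <= p.+3)%N ->
    `|trunc D A R c u t0 dt k j| <= B * `|tau D A R c j|.
  by move=> kN jp; rewrite /trunc normrZ ler_wpM2r// uB//; have [] := kI k kN.
have resk k : (k < N)%N -> `|residual D A R c F u t0 dt k
      - (dt ^+ p.+1 *: trunc D A R c u t0 dt k.+1 p.+1
         + dt ^+ p.+2 *: trunc D A R c u t0 dt k.+1 p.+2)| <= Cres * dt ^+ p.+3.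
  move=> kN; have [_ skI] := kI _ (ltnW kN); have [tk1I sk1I] := kI _ kN.
  exact: resB.
have dtp k l : (k <= l)%N -> dt ^+ l <= dt ^+ k by move=> ?; exact: ler_wiXn2l.
pose E := global_error c u t0 dt (V dt).
pose e k := E k - dt ^+ p.+1 *: trunc D A R c u t0 dt k p.+1.
have e1 : `|e 1%N| <= B1 * dt ^+ p.+2.
  have split3 (v t1 t2 : 'cV[K]_s) : v - t1 = (v - (t1 + t2)) + t2.
    by rewrite opprD addrA subrK.
  rewrite /e (split3 _ _ (dt ^+ p.+2 *: trunc D A R c u t0 dt 1 p.+2)).
  rewrite (le_trans (ler_normD _ _))// /B1 [leRHS]mulrDl [leRHS]addrC lerD//.
    rewrite (le_trans initdt)//.
    apply: (@le_trans _ _ (`|Ci| * dt ^+ p.+3)).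
      by rewrite ler_wpM2r// ler_norm.
    by rewrite ler_wpM2l// dtp.
  by rewrite normrZ ger0_norm// [leLHS]mulrC ler_wpM2r// truncB.
have Dv (v : 'cV[K]_s) r : 0 <= r -> `|v| <= r ->
    `|D *m v| <= (1 + s%:R * `|D|) * r /\ `|v| <= (1 + s%:R * `|D|) * r.
  move=> r0 vr; split; last by rewrite (le_trans vr)// ler_peMl// lerDl mulr_ge0.
  rewrite (le_trans (mulmx_norm_le _ _))// ler_pM ?mulr_ge0// lerDr//.
have [De1 e1'] := Dv _ _ (mulr_ge0 B10 (dtg p.+2)) e1.
apply: (rec dt (fun k => `|D *m e k|) (fun k => `|e k|) (fun k => `|E k|) N) => //.
- have : t0 + N%:R * dt <= tend := tN.
  by have := ler_norm (tend - t0); lra.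
- by rewrite -mulrA.
- by rewrite -mulrA.
- move=> k /andP[k1 kN].
  have split2 (v t1 : 'cV[K]_s) : v = t1 + (v - t1) by rewrite addrC subrK.
  rewrite [in leLHS](split2 (E k) (dt ^+ p.+1 *: trunc D A R c u t0 dt k p.+1)).
  rewrite (le_trans (ler_normD _ _))// lerD2r normrZ ger0_norm//.
  by rewrite mulrC ler_wpM2r// truncB// leqW.
- move=> k /andP[k1 kN].
  (* Both new vectors are images under [G]. Inserting [G] of the explicit map at the exact vector
     separates the propagated error, with constant [L], from the defect, with constant [M]. *)
  have VG : V dt k.+1 = G (explicit_map D A F dt (V dt k)).
    rewrite -[LHS]GK; congr G; rewrite /implicit_map /explicit_map.
    by rewrite {1}(schemedt k k1) addrK.
  have UG : exact_vec u t0 dt c k.+1 =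
      G (implicit_map R F dt (exact_vec u t0 dt c k.+1)) by rewrite GK.
  have resL : `|residual D A R c F u t0 dt k| <= (T + T2 + Cres) * dt ^+ p.+1.
    have split2 (v t1 : 'cV[K]_s) : v = (v - t1) + t1 by rewrite subrK.
    rewrite (split2 (residual D A R c F u t0 dt k)
      (dt ^+ p.+1 *: trunc D A R c u t0 dt k.+1 p.+1
       + dt ^+ p.+2 *: trunc D A R c u t0 dt k.+1 p.+2)).
    rewrite [leRHS]mulrDl [leRHS]addrC (le_trans (ler_normD _ _))// lerD//.
      by rewrite (le_trans (resk _ kN))// ler_wpM2l// dtp// ltnW.
    rewrite [leRHS]mulrDl (le_trans (ler_normD _ _))// lerD// normrZ ger0_norm//.
      by rewrite [leLHS]mulrC ler_wpM2r// truncB// leqW.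
    by rewrite [leLHS]mulrC ler_pM// ?truncB// dtp.
  have GL' := GL (V dt k, exact_vec u t0 dt c k) (conj I I).
  have GM' := GM (explicit_map D A F dt (exact_vec u t0 dt c k),
    implicit_map R F dt (exact_vec u t0 dt c k.+1)) (conj I I).
  rewrite /= in GL' GM'.
  rewrite /E /global_error {1}VG {1}UG.
  rewrite -(subrKA (G (explicit_map D A F dt (exact_vec u t0 dt c k)))).
  rewrite (le_trans (ler_normD _ _))// /L'.
  have LE : L * `|E k| <= `|L| * `|E k| by rewrite ler_wpM2r// ler_norm.
  have MR : M * `|residual D A R c F u t0 dt k| <=
      `|M| * ((T + T2 + Cres) * dt ^+ p.+1).
    rewrite (@le_trans _ _ (`|M| * `|residual D A R c F u t0 dt k|))//.
      by rewrite ler_wpM2r// ler_norm.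
    by rewrite ler_wpM2l.
  have C0 : 0 <= T + T2 + Cres by rewrite !addr_ge0.
  have : 0 <= `|L| * dt ^+ p.+1 by rewrite mulr_ge0.
  have : 0 <= `|M| * (T + T2 + Cres) * `|E k| by rewrite !mulr_ge0.
  move: (le_trans GL' LE) (le_trans GM' MR); rewrite /E /global_error.
  by lra.
- move=> k /andP[k1 kN] Ek Ek1.
  by apply: (step dt (V dt) k) => //; [exact: tk|exact: schemedt|exact: resk].
- by rewrite N1 leqnn.
Unshelve. all: by end_near.
Qed.

(** * Order [p+2] after post-processing *)

Theorem mainTheorem2 (K : realType) (s p : nat)
  (* the ODE, on ]a, b[, and the interval of integration [t0, tend] *)
  (F u : K -> K) (a b t0 tend : K)
  (D A R : 'M[K]_s) (c : 'cV[K]_s)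
  (* numerical solution for the time step dt, at step n *)
  (V : K -> nat -> 'cV[K]_s)
  (* data of the post-processor for the time step dt, at step n *)
  (P : K -> nat -> 'I_p.+2 -> {poly K})
  (T : K -> nat -> 'M[K[i]]_(s + s))
  (star : K -> nat -> 'I_(s + s) -> bool)
  (hs : (1 <= s)%N) (hp : (1 <= p)%N) (hsp : (p + 3 <= 2 * s)%N)
  (hat0 : a < t0) (htendb : tend < b)
  (hF : smooth_on p.+2 F setT)
  (hu : smooth_on p.+3 u `]a, b[)
  (hode : solves_on F u `]a, b[)
  (hc_sorted : forall i j : 'I_s, (i <= j)%N -> c i 0 <= c j 0)
  (hc_last : forall i : 'I_s, i.+1 = s -> c i 0 = 0)
  (hD_rank : \rank D = 1%N)
  (hD_ones : D *m ones K s = ones K s)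
  (htau : forall j, (1 <= j <= p)%N -> tau D A R c j = 0)
  (hDtau1 : D *m tau D A R c p.+1 = 0)
  (hDtau2 : D *m tau D A R c p.+2 = 0)
  (hDARtau : D *m (A + R) *m tau D A R c p.+1 = 0)
  (hstanding : exists M L : K, \forall dt \near 0^'+,
     exists G : 'cV[K]_s -> 'cV[K]_s,
       [/\ cancel (implicit_map R F dt) G,
           cancel G (implicit_map R F dt),
           M.-lipschitz G &
           L.-lipschitz (G \o explicit_map D A F dt)])
  (hscheme : \forall dt \near 0^'+, forall n, (1 <= n)%N ->
     V dt n.+1 = D *m V dt n + dt *: (A *m map_mx F (V dt n))
                 + dt *: (R *m map_mx F (V dt n.+1)))
  (hinit : exists C : K, \forall dt \near 0^'+,
     `|(V dt 1%N - exact_vec u t0 dt c 1)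
       - (dt ^+ p.+1 *: trunc D A R c u t0 dt 1 p.+1
          + dt ^+ p.+2 *: trunc D A R c u t0 dt 1 p.+2)| <= C * dt ^+ p.+3)
  (hpost : \forall dt \near 0^'+, forall n, (2 <= n)%N ->
     tgrid t0 dt n <= tend ->
     let tn := tgrid t0 dt n in
     let tautilde := col_mx (tau D A R c p.+1) (tau D A R c p.+1) in
     let Pvec := fun k => values (shiftp (P dt n k) tn)
                                 (stack2 (stages t0 dt c) n) in
     [/\ forall k, (size (P dt n k) <= p.+2)%N,
         lspan (fun k => shiftp (P dt n k) tn)
           = lspan (fun k : 'I_p.+2 => ('X - tn%:P) ^+ k),
         (tautilde \notin <<[seq Pvec k | k : 'I_p.+2]>>)%VS,
         T dt n \in unitmx &
         (forall j : 'I_(s + s), j = 0%N :> nat ->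
            col j (T dt n) = toC tautilde) /\
         (forall (k : 'I_p.+2) (j : 'I_(s + s)), j = k.+1 :> nat ->
            col j (T dt n) = toC (Pvec k))])
  (hPhi : exists M : K, \forall dt \near 0^'+, forall n, (2 <= n)%N ->
     tgrid t0 dt n <= tend ->
     `|postproc p.+2 (star dt n) (T dt n)| <= M%:C) :
  exists C : K, \forall dt \near 0^'+, forall n, (2 <= n)%N ->
    tgrid t0 dt n <= tend ->
    `|postproc p.+2 (star dt n) (T dt n) *m toC (stack2 (V dt) n)
      - toC (stack2 (exact_vec u t0 dt c) n)| <= (C * dt ^+ p.+2)%:C.
Proof.
have [C C0 errC] := global_error_expansion hs hat0 htendb hF hu hode hc_sorted
  hc_last hD_rank hD_ones htau hDtau1 hDtau2 hDARtau hstanding hscheme hinit.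
have c0 := abscissas_le0 hc_sorted hc_last.
have [M hM] := hPhi.
pose lo := (a + t0) / 2.
have lo_t0 : lo < t0 by rewrite /lo; lra.
have Iab : `[lo, tend] `<=` `]a, b[.
  move=> z /=; rewrite !in_itv /= => /andP[loz ztend].
  by rewrite (le_lt_trans ztend) // (lt_le_trans _ loz)// /lo; lra.
have [B B0 uB] := smooth_on_bounded hu Iab.
have du j z : (j < p.+3)%N -> z \in `[lo, tend] -> derivable (derive1n j u) z 1.
  by move=> jp zI; have [+ _] := hu z (Iab z zI); apply.
pose tau1 := tau D A R c p.+1.
pose Ce := C + B * `|tau1|.
pose Cq := B * (1 + `|c|) ^+ p.+2.
have Ce0 : 0 <= Ce by rewrite addr_ge0// mulr_ge0.
have Cq0 : 0 <= Cq by rewrite mulr_ge0// exprn_ge0// addr_ge0.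
exists ((s + s)%:R * `|M| * (Ce + Cq) + Cq).
apply: filter_app hpost; near=> dt => postdt.
have dt0 : 0 < dt by near: dt; exact: nbhs_right_gt.
have dt0' := ltW dt0.
have dtc : dt * `|c| <= t0 - lo.
  have c1 : 0 < 1 + `|c| by rewrite ltr_pwDl.
  apply: (@le_trans _ _ (dt * (1 + `|c|))); first by rewrite ler_pM2l// lerDr.
  rewrite -ler_pdivlMr//; near: dt; apply: nbhs_right_le.
  by rewrite divr_gt0// subr_gt0.
have errdt : forall n, (1 <= n)%N -> tgrid t0 dt n <= tend ->
    `|global_error c u t0 dt (V dt) n
      - dt ^+ p.+1 *: trunc D A R c u t0 dt n p.+1| <= C * dt ^+ p.+2.
  by near: dt.
have Mdt : forall n, (2 <= n)%N -> tgrid t0 dt n <= tend ->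
     `|postproc p.+2 (star dt n) (T dt n)| <= M%:C by near: dt.
(* With [n = m.+2] the older step [m.+1] is at least [1], so the error expansion holds at both
   steps. *)
move=> [|[|m]]// n2 tn; set n := m.+2 in n2 tn *.
have [_ spanP _ unitT [T0 TP]] := postdt n n2 tn.
set tnn := tgrid t0 dt n in spanP TP.
have sm : (p.+2 < s + s)%N by rewrite addnn -mul2n -addn3.
pose y := values (taylor_poly p.+2 u tnn) (stack2 (stages t0 dt c) n).
have kills : postproc p.+2 (star dt n) (T dt n) *m toC (col_mx tau1 tau1) = 0.
  have s0 : (0 < s + s)%N by exact: leq_ltn_trans sm.
  rewrite -(T0 (Ordinal s0) erefl) postproc_eigen// mxE /=.
  by rewrite scale0r.
(* Equality of the spans puts the Taylor polynomial, of degree at most [p+1], among the combinations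
   of the shifted [P]. *)
have fixes : postproc p.+2 (star dt n) (T dt n) *m toC y = toC y.
  apply: postproc_values sm unitT TP _.
  by rewrite spanP; exact: lspan_taylor_poly.
have tn1 : tgrid t0 dt m.+1 <= tend by apply: le_trans tn; exact: tgrid_le.
have [tnI snI] := stages_in dt0' c0 dtc tn.
have [tn1I sn1I] := stages_in dt0' c0 dtc tn1.
have dtg k : 0 <= dt ^+ k by exact: exprn_ge0.
have col_le (v w : 'cV[K]_s) (r : K) : `|v| <= r -> `|w| <= r -> `|col_mx v w| <= r.
  move=> vr wr; apply: mx_norm_le => [|i j]; first exact: le_trans vr.
  by rewrite mxE; case: splitP => k _; rewrite (le_trans (mx_norm_entry_le _ _ _)).
pose d := derive1n p.+1 u tnn.
have tnE : tnn - tgrid t0 dt m.+1 = dt.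
  by rewrite /tnn /n /tgrid -[m.+2%:R]natr1; ring.
(* Both halves must carry the same multiple of [tau1]. In the upper half the derivative at [t_(n-1)]
   is replaced by the one at [t_n], which costs [O(dt)] times [dt ^+ p.+1]. *)
have errE : `|stack2 (V dt) n - stack2 (exact_vec u t0 dt c) n
    - (dt ^+ p.+1 * d) *: col_mx tau1 tau1| <= Ce * dt ^+ p.+2.
  rewrite /stack2 scale_col_mx opp_col_mx add_col_mx opp_col_mx add_col_mx.
  apply: col_le; last first.
    rewrite -scalerA (le_trans (errdt n isT tn))// ler_wpM2r// lerDl mulr_ge0//.
  set d1 := derive1n p.+1 u (tgrid t0 dt m.+1).
  have -> : V dt n.-1 - exact_vec u t0 dt c n.-1 - (dt ^+ p.+1 * d) *: tau1 =
      (global_error c u t0 dt (V dt) m.+1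
       - dt ^+ p.+1 *: trunc D A R c u t0 dt m.+1 p.+1)
      - (dt ^+ p.+1 * (d - d1)) *: tau1.
    rewrite /trunc -/tau1 -/d1 scalerA -[RHS]addrA -opprD -scalerDl.
    by rewrite -mulrDr [d1 + _]addrC subrK.
  rewrite (le_trans (ler_normB _ _))// /Ce mulrDl lerD ?errdt//.
  have [xi [xiI _ _ dE]] := mvt_between (fun z => @du p.+1 z (leqnSn p.+2)) tnI tn1I.
  rewrite /d /d1 dE tnE -derive1nS normrZ.
  rewrite 2!normrM (ger0_norm (dtg _)) (gtr0_norm dt0).
  have -> : B * `|tau1| * dt ^+ p.+2 = dt ^+ p.+1 * (B * dt) * `|tau1|.
    by rewrite (exprS dt p.+1); ring.
  by rewrite ler_wpM2r// ler_wpM2l// ler_wpM2r// uB.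
have errQ : `|stack2 (exact_vec u t0 dt c) n - y| <= Cq * dt ^+ p.+2.
  have stack_in i : stack2 (stages t0 dt c) n i 0 \in `[lo, tend] /\
      `|stack2 (stages t0 dt c) n i 0 - tnn| <= (1 + `|c|) * dt.
    have cdt k : `|c k 0 * dt| <= `|c| * dt.
      by rewrite normrM (gtr0_norm dt0) ler_wpM2r// mx_norm_entry_le.
    rewrite mulrDl mul1r /stack2 mxE; case: splitP => k _; split=> //; rewrite mxE.
      have -> : tgrid t0 dt n.-1 + c k 0 * dt - tnn = c k 0 * dt - dt.
        by rewrite -[n.-1]/m.+1; move: tnE; lra.
      by rewrite [leRHS]addrC (le_trans (ler_normB _ _))// lerD// gtr0_norm.
    by rewrite addrC addKr (le_trans (cdt k))// lerDr.
  have -> : stack2 (exact_vec u t0 dt c) n = map_mx u (stack2 (stages t0 dt c) n).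
    by rewrite /stack2 map_col_mx.
  apply: mx_norm_le => [|i j]; first by rewrite mulr_ge0.
  rewrite ord1 !mxE.
  have [iI idt] := stack_in i; rewrite mxE in iI idt.
  rewrite (le_trans (taylor_poly_error _ (fun z => @uB p.+2 z (leqnSn _)) iI tnI))//.
    by move=> j' z jp; apply: du; exact: ltnW.
  rewrite /Cq -mulrA -exprMn ler_wpM2l// lerXn2r ?nnegrE//.
  by rewrite mulr_ge0// addr_ge0.
have M0 : `|postproc p.+2 (star dt n) (T dt n)| <= `|M|%:C.
  by rewrite (le_trans (Mdt n n2 tn))// lecR ler_norm.
apply: (le_trans (postproc_error (dt ^+ p.+1 * d) _ _ (normr_ge0 M) M0 kills fixes)).
rewrite lecR mulrDl lerD//.
rewrite -[leRHS]mulrA ler_wpM2l ?mulr_ge0// mulrDl.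
by rewrite lerD//; exact: errE.
Unshelve. all: by end_near.
Qed.
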